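(* Let $\xi$ have the half-logistic distribution, i.e., $\xi$ is a nonnegative random variable with density $$f(x)=\frac{2e^{-x}}{(1+e^{-x})^2},\quad x\ge 0.$$ For an integer $n\ge 1$ let $X_n=\xi^n$ and $Y_n=\xi_1\xi_2\cdots\xi_n$, where $\xi_1,\ldots,\xi_n$ are independent copies of $\xi$. Then $X_n$ is M-det if and only if $Y_n$ is M-det, and this is true if and only if $n\le 2$. This means that for each $n$, the two random variables $X_n$ and $Y_n$ share the same moment determinacy property.
   Context: A nonnegative random variable with all moments finite is called M-det (moment determinate, in the sense of the Stieltjes moment problem) if its distribution is the only probability distribution on $[0,\infty)$ having its moment sequence; otherwise it is called M-indet. *)

(* Defs.v *)
From HB Require Import structures.
From mathcomp Require Import all_boot all_order all_algebra.
From mathcomp Require Import all_classical all_reals all_analysis.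

Set Implicit Arguments.
Unset Strict Implicit.
Unset Printing Implicit Defensive.

Import Order.TTheory GRing.Theory Num.Theory.
Import numFieldNormedType.Exports.

Local Open Scope classical_set_scope.
Local Open Scope ring_scope.

Definition half_logistic_pdf (R : realType) (x : R) : R :=
  if 0 <= x then 2 * expR (- x) / (1 + expR (- x)) ^+ 2 else 0.

Section RandomVariables.
Context d (T : measurableType d) (R : realType) (P : probability T R).

Definition has_density (X : {RV P >-> R}) (f : R -> R) : Prop :=
  forall A : set R, measurable A ->
    distribution P X A = (\int[lebesgue_measure]_(x in A) (f x)%:E)%E.

(* Laws are compared on measurable sets only: the value of a measure on a
   non-measurable set carries no meaning. *)
Definition same_law (X Y : {RV P >-> R}) : Prop :=
  forall A : set R, measurable A -> distribution P X A = distribution P Y A.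

Definition mutually_independent (I : finType) (X : I -> {RV P >-> R}) : Prop :=
  forall (J : {set I}) (A : I -> set R), (forall i, measurable (A i)) ->
    P (\bigcap_(i in [set` J]) (X i @^-1` A i)) =
    (\prod_(i in J) P (X i @^-1` A i))%E.

End RandomVariables.

Section MomentProblem.
Context (R : realType).
Implicit Types mu nu : probability R R.

Definition supported_on_nonneg mu : Prop := mu `[0, +oo[%classic = 1%E.

Definition moment mu (k : nat) : \bar R := (\int[mu]_x (x ^+ k)%:E)%E.

Definition finite_moments mu : Prop :=
  forall k : nat, mu.-integrable setT (fun x => (x ^+ k)%:E).

(* For nu supported on [0, +oo[ the moments are integrals of functions that are
   nonnegative nu-almost everywhere, so the equality with the finite moments of
   mu forces those of nu to be finite. *)
Definition stieltjes_unique mu : Prop :=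
  forall nu, supported_on_nonneg nu -> (forall k, moment nu k = moment mu k) ->
    forall A : set R, measurable A -> nu A = mu A.

End MomentProblem.

(* Both notions are reserved for nonnegative variables with finite moments, so
   M_indet is not the plain negation of M_det. *)
Definition M_det d (T : measurableType d) (R : realType) (P : probability T R)
    (X : {RV P >-> R}) : Prop :=
  [/\ supported_on_nonneg (distribution P X), finite_moments (distribution P X)
    & stieltjes_unique (distribution P X)].

Definition M_indet d (T : measurableType d) (R : realType) (P : probability T R)
    (X : {RV P >-> R}) : Prop :=
  [/\ supported_on_nonneg (distribution P X), finite_moments (distribution P X)
    & ~ stieltjes_unique (distribution P X)].

(* Main.v *)
Require Import Defs.
From HB Require Import structures.
From mathcomp Require Import all_boot all_order all_algebra.
From mathcomp Require Import all_classical all_reals all_analysis.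
From mathcomp Require Import measurable_realfun ring lra.

(** The k-th moments of both variables grow like k! ^ n up to geometric factors.
    For n <= 2 this growth is slow enough for the moments on the half-line to
    determine the law, and for n >= 3 the tails exp(- a x ^ (1 / n)) that come
    with it leave room for a perturbation that no moment detects.

    Determinacy for n <= 2. If the k-th moment of mu is at most
    C b ^ (2 k) (2 k)!, the cosine transform, the integral of cos(t sqrt x) with
    respect to mu, is analytic in t, and its Taylor series converges in a disc
    whose radius does not depend on the centre. Its derivatives at 0 are
    moments of mu up to sign, or 0. Another measure with the same moments
    therefore has the same transform near 0 and, moving the centre by steps
    of fixed length, on the half-line ([cos_transform_eq]). The Laplace transform
    in t turns this into equality of the integrals of a / (a ^ 2 + x)
    ([laplace_cos_transform]), that is, of 1 / (z + x) for all z > 0. Difference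
    quotients in z yield the powers of this function ([resolvent_pow_eq]); hence
    the integrals of polynomials in y = 1 / (1 + x) agree, and suitable
    polynomials (1 - y ^ n) ^ N converge boundedly to indicators of rays
    ([ray_eq_nonneg]). This gives [moment_growth_unique].

    Indeterminacy for n >= 3. Let b = a tan(pi / n). The integral of
    u ^ j exp(- a u) sin(b u) over the half-line is a multiple of
    sin((j + 1) pi / n) ([integral_damped_sine]), so the function
    u ^ (n - 1) exp(- a u) sin(b u) is orthogonal to u ^ (n k) for every k. A law
    that dominates the image of c u ^ (n - 1) exp(- a u) du under u |-> u ^ n can be
    perturbed by the image of this function without changing a moment
    ([stretched_minorant_not_unique]).

    Both laws have such a minorant. For the power it follows from the lower
    bound exp(- x) / 2 for the half-logistic density ([power_law_minorant]). For
    the product, mutual independence shows that each new factor acts on the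
    law by multiplicative convolution with the half-logistic law
    ([prefix_law_mult_conv]), and such a convolution carries a minorant of
    exponent n to one of exponent n + 1 ([stretched_minorant_mult_conv]). *)

Set Implicit Arguments.
Unset Strict Implicit.
Unset Printing Implicit Defensive.

Import Order.TTheory GRing.Theory Num.Theory.
Import numFieldNormedType.Exports.

Local Open Scope classical_set_scope.
Local Open Scope ring_scope.

(** * Real integrals and the half-line *)

Section real_integrable.
Context d (T : measurableType d) {R : realType}.
Variables (mu : {measure set T -> \bar R}) (D : set T).
Hypothesis mD : measurable D.
Implicit Types f g : T -> R.

Lemma Rintegrable_scale (k : R) f : mu.-integrable D (EFin \o f) ->
  mu.-integrable D (EFin \o (fun x => k * f x)).
Proof. by move=> fi; have := integrableZl mD k fi. Qed.

Lemma Rintegrable_add f g :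
  mu.-integrable D (EFin \o f) -> mu.-integrable D (EFin \o g) ->
  mu.-integrable D (EFin \o (fun x => f x + g x)).
Proof. by move=> fi gi; have := integrableD mD fi gi. Qed.

Lemma Rintegrable_sub f g :
  mu.-integrable D (EFin \o f) -> mu.-integrable D (EFin \o g) ->
  mu.-integrable D (EFin \o (fun x => f x - g x)).
Proof. by move=> fi gi; have := integrableB mD fi gi. Qed.

Lemma Rintegrable_le f g : measurable_fun D f ->
  (forall x, D x -> `|f x| <= g x) ->
  mu.-integrable D (EFin \o g) -> mu.-integrable D (EFin \o f).
Proof.
move=> mf fg; apply: le_integrable => //; first exact/measurable_EFinP.
by move=> x Dx; rewrite lee_fin (le_trans (fg _ Dx))// ler_norm.
Qed.

End real_integrable.

Section calculus.
Context {R : realType}.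
Implicit Types f F : R -> R.

Lemma is_derive_continuous f (g : R -> R) :
  (forall x, is_derive x (1 : R) f (g x)) -> continuous f.
Proof.
move=> df x; apply: differentiable_continuous.
by apply/derivable1_diffP; exact: ex_derive.
Qed.

Lemma FTC_itv f F (a b : R) : continuous f ->
  (forall x, is_derive x (1 : R) F (f x)) -> a < b ->
  (\int[lebesgue_measure]_(x in `[a, b]) (f x)%:E = (F b - F a)%:E)%E.
Proof.
move=> cf dF ab; have cF := is_derive_continuous dF.
rewrite (@continuous_FTC2 _ f F)//.
- exact: continuous_subspaceT.
- split=> [x _||]; first exact: ex_derive.
  + exact/cvg_at_right_filter/cF.
  + exact/cvg_at_left_filter/cF.
- by move=> x _; rewrite derive1E derive_val.
Qed.

Lemma Rintegral_dominated d (T : measurableType d)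
    (mu : {measure set T -> \bar R}) (D : set T) (h : nat -> T -> R)
    (f g : T -> R) : measurable D ->
  (forall n, measurable_fun D (h n)) -> measurable_fun D f ->
  (forall x, D x -> h n x @[n --> \oo] --> f x) ->
  mu.-integrable D (EFin \o g) ->
  (forall n x, D x -> `|h n x| <= g x) ->
  \int[mu]_(x in D) h n x @[n --> \oo] --> \int[mu]_(x in D) f x.
Proof.
move=> mD mh mf hf ig hg.
have [||||fi _ hcvg] := @dominated_convergence _ _ _ mu _ mD
  (fun n => EFin \o h n) (EFin \o f) (EFin \o g) _ _ _ ig.
- by move=> n; exact/measurable_EFinP.
- exact/measurable_EFinP.
- by apply: aeW => x Dx; apply/fine_cvgP; split; [exact: nearW|exact: hf].
- by apply: aeW => x n Dx; rewrite lee_fin hg.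
apply: fine_cvg; rewrite fineK; last exact: integrable_fin_num fi.
exact: hcvg.
Qed.

(** The integrals over the segments from 0 to n are computed by the
    fundamental theorem, and integrability of f lets n go to infinity by
    dominated convergence. *)
Lemma FTC_halfline f F (l : R) : continuous f ->
  (forall x, is_derive x (1 : R) F (f x)) ->
  lebesgue_measure.-integrable `[0%R, +oo[ (EFin \o f) ->
  F n%:R @[n --> \oo] --> l ->
  \int[lebesgue_measure]_(x in `[0%R, +oo[) f x = l - F 0.
Proof.
move=> cf dF fi Fl.
have mf : measurable_fun setT f by exact: continuous_measurable_fun.
pose h (n : nat) : R -> R := f \_ `[0, n.+1%:R].
have hE n : \int[lebesgue_measure]_(x in `[0%R, +oo[) h n x = F n.+1%:R - F 0.
  rewrite -Rintegral_mkcondr /Rintegral setIidr; last first.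
    by move=> x /=; rewrite !in_itv/= => /andP[-> _].
  by rewrite (FTC_itv cf dF).
have : \int[lebesgue_measure]_(x in `[0%R, +oo[) h n x @[n --> \oo] -->
    \int[lebesgue_measure]_(x in `[0%R, +oo[) f x.
  apply: (@Rintegral_dominated _ _ lebesgue_measure `[0%R, +oo[ h f (fun x => `|f x|)) => //.
  - move=> n; apply/measurable_restrict => //; exact: measurable_funS mf.
  - exact: measurable_funS mf.
  - move=> x; rewrite /= in_itv/= andbT => x0; apply: cvg_near_cst.
    near=> n; rewrite /h patchE mem_set//= in_itv/= x0/=.
    rewrite (@le_trans _ _ n%:R)//; first by near: n; exact: nbhs_infty_ger.
    by rewrite ler_nat.
  - exact: (integrable_norm fi).
  - by move=> n x _; rewrite /h patchE; case: ifPn; rewrite // normr0.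
under eq_cvg do rewrite hE.
move/cvg_unique; apply => //.
by apply: cvgB; [rewrite (cvg_shiftS (fun n => F n%:R))|exact: cvg_cst].
Unshelve. all: by end_near. Qed.

End calculus.

Section pointwise_derivatives.
Context {R : realType}.
Implicit Types f g : R -> R.
Implicit Types x : R.

Lemma is_derive_mulf f g x (a b : R) :
  is_derive x (1 : R) f a -> is_derive x (1 : R) g b ->
  is_derive x (1 : R) (fun y => f y * g y) (a * g x + f x * b).
Proof.
move=> df dg; have := is_deriveM df dg.
by rewrite addrC /GRing.scale/= (mulrC (g x)).
Qed.

Lemma is_derive_addf f g x (a b : R) :
  is_derive x (1 : R) f a -> is_derive x (1 : R) g b ->
  is_derive x (1 : R) (fun y => f y + g y) (a + b).
Proof. by move=> df dg; exact: is_deriveD. Qed.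

Lemma is_derive_subf f g x (a b : R) :
  is_derive x (1 : R) f a -> is_derive x (1 : R) g b ->
  is_derive x (1 : R) (fun y => f y - g y) (a - b).
Proof. by move=> df dg; exact: is_deriveB. Qed.

Lemma is_derive_compf f g x (a b : R) :
  is_derive (g x) (1 : R) f a -> is_derive x (1 : R) g b ->
  is_derive x (1 : R) (fun y => f (g y)) (a * b).
Proof. by move=> df dg; exact: is_derive1_comp. Qed.

Lemma is_derive_linear (a x : R) : is_derive x (1 : R) (fun y => a * y) a.
Proof.
have := @is_derive_mulf (fun=> a) id x 0 1 (is_derive_cst _ _ _)
  (is_derive_id _ _).
by rewrite mul0r mulr1 add0r.
Qed.

Lemma is_derive_monomial k x :
  is_derive x (1 : R) (fun y => y ^+ k) (k%:R * x ^+ k.-1).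
Proof.
have := @is_deriveX R R id k x 1 1 (is_derive_id _ _).
by rewrite exprfctE /GRing.scale/= mulr1.
Qed.

Lemma is_derive_expN (a x : R) :
  is_derive x (1 : R) (fun y => expR (- (a * y))) (- a * expR (- (a * x))).
Proof.
rewrite mulrC; apply: (@is_derive_compf expR (fun y => - (a * y))).
under eq_fun do rewrite -mulNr.
exact: is_derive_linear.
Qed.

Lemma is_derive_cosf f x (a : R) : is_derive x (1 : R) f a ->
  is_derive x (1 : R) (fun y => cos (f y)) (- a * sin (f x)).
Proof.
by move=> df; rewrite mulNr mulrC -mulNr; exact: (@is_derive_compf cos).
Qed.

Lemma is_derive_sinf f x (a : R) : is_derive x (1 : R) f a ->
  is_derive x (1 : R) (fun y => sin (f y)) (a * cos (f x)).
Proof. by move=> df; rewrite mulrC; exact: (@is_derive_compf sin). Qed.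

End pointwise_derivatives.

Section exponential_integrals.
Context {R : realType}.
Local Notation leb := (@lebesgue_measure R).

Lemma continuous_expN (a : R) : continuous (fun x : R => expR (- (a * x))).
Proof. exact: (is_derive_continuous (is_derive_expN a)). Qed.

Lemma continuous_monomial_expN k (a : R) :
  continuous (fun x : R => x ^+ k * expR (- (a * x))).
Proof.
have dF x := is_derive_mulf (is_derive_monomial k x) (is_derive_expN a x).
exact: is_derive_continuous dF.
Qed.

Lemma measurable_expN (a : R) :
  measurable_fun [set: R] (fun x : R => expR (- (a * x))).
Proof. by apply: continuous_measurable_fun; exact: continuous_expN. Qed.

Lemma measurable_monomial_expN k (a : R) :
  measurable_fun [set: R] (fun x : R => x ^+ k * expR (- (a * x))).
Proof.
by apply: continuous_measurable_fun; exact: continuous_monomial_expN.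
Qed.

Lemma pow_le_expR (x : R) k : 0 <= x -> x ^+ k <= k`!%:R * expR x.
Proof.
move=> x0; rewrite -ler_pdivrMl ?ltr0n ?fact_gt0//.
case: k => [|k]; first by rewrite expr0 fact0 invr1 mul1r (le_trans _ (expR_ge1Dx _)) ?lerDl.
by rewrite mulrC (le_trans _ (expR_ge1Dxn k x0))// lerDr.
Qed.

(** Half of the decay absorbs the power of x: with y = a x / 2, the k-th term
    of the exponential series bounds y ^ k by k! exp y. *)
Lemma monomial_expN_le (a x : R) k : 0 < a -> 0 <= x ->
  x ^+ k * expR (- (a * x)) <= (2 / a) ^+ k * k`!%:R * expR (- (a / 2 * x)).
Proof.
move=> a0 x0; have ax0 : 0 <= a / 2 * x by rewrite mulr_ge0// divr_ge0// ltW.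
have -> : - (a * x) = - (a / 2 * x) + - (a / 2 * x) by field.
have -> : x ^+ k = (2 / a) ^+ k * (a / 2 * x) ^+ k.
  by rewrite -exprMn; congr (_ ^+ _); field; rewrite gt_eqF.
rewrite expRD -!mulrA ler_wpM2l ?exprn_ge0 ?divr_ge0 ?(ltW a0)//.
rewrite mulrA ler_wpM2r ?expR_ge0// expRN ler_pdivrMr ?expR_gt0//.
by rewrite mulrA; exact: pow_le_expR.
Qed.

(** This is the total mass of the exponential distribution of rate a. *)
Lemma integral_expN (a : R) : 0 < a ->
  (\int[leb]_(x in `[0%R, +oo[) (expR (- (a * x)))%:E = (a^-1)%:E)%E.
Proof.
move=> a0.
have : (\int[leb]_(x in `[0%R, +oo[) (a%:E * (expR (- (a * x)))%:E) = 1)%E.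
  rewrite -(integral_exponential_pdf a0) integral_mkcond.
  apply: eq_integral => x _.
  by rewrite /exponential_pdf !patchE mulNr; case: ifPn.
rewrite ge0_integralZl//=; last 2 first.
- apply/measurable_EFinP; apply: measurable_funTS; exact: measurable_expN.
- by rewrite lee_fin ltW.
move=> /(congr1 (fun z => (a^-1)%:E * z)%E).
by rewrite muleA -EFinM mulVf ?gt_eqF// mul1e mule1.
Qed.

Lemma integrable_expN (a : R) : 0 < a ->
  leb.-integrable `[0%R, +oo[ (EFin \o (fun x => expR (- (a * x)))).
Proof.
move=> a0; apply/integrableP; split.
  apply/measurable_EFinP; apply: measurable_funTS; exact: measurable_expN.
under eq_integral do rewrite /= ger0_norm ?expR_ge0//.
by rewrite integral_expN// ltry.
Qed.

Lemma integrable_monomial_expN k (a : R) : 0 < a ->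
  leb.-integrable `[0%R, +oo[ (EFin \o (fun x => x ^+ k * expR (- (a * x)))).
Proof.
move=> a0.
have a20 : 0 < a / 2 by rewrite divr_gt0.
apply: le_integrable (integrableZl _ ((2 / a) ^+ k * k`!%:R) (integrable_expN a20)) => //.
  apply/measurable_EFinP; apply: measurable_funTS; exact: measurable_monomial_expN.
move=> x /=; rewrite in_itv/= andbT => x0; rewrite lee_fin.
rewrite ger0_norm ?mulr_ge0 ?exprn_ge0 ?expR_ge0//.
rewrite ger0_norm; first exact: monomial_expN_le.
by rewrite !mulr_ge0 ?exprn_ge0 ?expR_ge0// mulr_ge0// ltW// invr_gt0.
Qed.

Lemma cvgn_expN (a : R) : 0 < a -> expR (- (a * n%:R)) @[n --> \oo] --> (0 : R).
Proof.
move=> a0; under eq_cvg do rewrite -mulNr expRM_natr.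
by apply: cvg_expr; rewrite ger0_norm ?expR_ge0// expR_lt1 oppr_lt0.
Qed.

Lemma cvgn_monomial_expN k (a : R) : 0 < a ->
  n%:R ^+ k * expR (- (a * n%:R)) @[n --> \oo] --> (0 : R).
Proof.
move=> a0; apply: (@squeeze_cvgr _ _ _ _ (fun=> 0)
  (fun n => (2 / a) ^+ k * k`!%:R * expR (- (a / 2 * n%:R)))).
- apply: nearW => n; rewrite monomial_expN_le// andbT.
  by rewrite mulr_ge0 ?exprn_ge0 ?expR_ge0.
- exact: cvg_cst.
- rewrite -[X in _ --> X](mulr0 ((2 / a) ^+ k * k`!%:R)).
  by apply: cvgMr; apply: cvgn_expN; rewrite divr_gt0.
Qed.

End exponential_integrals.

(** * Image measures, perturbations and moments *)

(** If la is the image under phi of the measure of density g with respect to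
    mu, integrals against la pull back to mu. The
    relation is required on measurable sets only, where laws are known. *)
Section image_density.
Local Open Scope ereal_scope.
Context d d' (T : measurableType d) (T' : measurableType d') {R : realType}.
Variables (mu : {measure set T -> \bar R}) (la : {measure set T' -> \bar R}).
Variables (phi : T -> T') (g : T -> R).
Hypotheses (mphi : measurable_fun setT phi) (mg : measurable_fun setT g).
Hypothesis g_ge0 : forall x, (0 <= g x)%R.
Hypothesis laE : forall A, measurable A ->
  la A = \int[mu]_(x in phi @^-1` A) (g x)%:E.

Import HBNNSimple.

Let mEg : measurable_fun setT (EFin \o g). Proof. exact/measurable_EFinP. Qed.

Let integral_image_density_nnsfun (h : {nnsfun T' >-> R}) :
  \int[la]_y (h y)%:E = \int[mu]_x ((h (phi x))%:E * (g x)%:E).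
Proof.
have mpre A : measurable A -> measurable (phi @^-1` A).
  by move=> mA; rewrite -[X in measurable X]setTI; exact: mphi.
rewrite integralT_nnsfun sintegralE.
transitivity (\int[mu]_x (\sum_(y \in range h)
    (y%:E * ((\1_(phi @^-1` (h @^-1` [set y])) x)%:E * (g x)%:E)))); last first.
  apply: eq_integral => x _.
  under eq_fsbigr do rewrite muleA.
  rewrite -ge0_mule_fsuml; last by move=> y; exact: nnfun_muleindic_ge0.
  congr (_ * _); rewrite [in RHS]fimfunE -fsumEFin//.
have mI y : measurable_fun setT (fun x =>
    (\1_(phi @^-1` (h @^-1` [set y])) x)%:E * (g x)%:E).
  apply: emeasurable_funM => //; apply/measurable_EFinP.
  exact/measurable_indic/mpre.
rewrite ge0_integral_fsum//; last 2 first.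
- by move=> y; exact: measurable_funeM.
- move=> y x _; rewrite muleA mule_ge0 ?lee_fin//.
  exact: (@nnfun_muleindic_ge0 _ _ _ _ _).
apply: eq_fsbigr => y; rewrite inE => -[t _ <-].
rewrite ge0_integralZl//; last 2 first.
- by move=> x _; rewrite mule_ge0// lee_fin.
- by rewrite lee_fin.
rewrite laE//; congr (_ * _).
rewrite [LHS]integral_mkcond; apply: eq_integral => x _.
by rewrite epatch_indic muleC.
Qed.

Lemma ge0_integral_image_density (F : T' -> \bar R) :
  measurable_fun setT F -> (forall y, 0 <= F y) ->
  \int[la]_y F y = \int[mu]_x (F (phi x) * (g x)%:E).
Proof.
move=> mF F0; pose h := nnsfun_approx measurableT mF.
have FE y : F y = limn (fun n => (h n y)%:E).
  by apply/esym/cvg_lim => //; exact: cvg_nnsfun_approx.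
have hnd y : {homo (fun n => h n y) : m n / (m <= n)%N >-> (m <= n)%R}.
  by move=> m n mn; exact/lefP/nd_nnsfun_approx.
transitivity (limn (fun n => \int[la]_y (h n y)%:E)).
  under eq_integral do rewrite FE.
  rewrite monotone_convergence//.
  - by move=> n; exact/measurable_EFinP.
  - by move=> n y _; rewrite lee_fin.
  - by move=> y _ m n mn; rewrite lee_fin; exact: hnd.
under eq_fun do rewrite integral_image_density_nnsfun.
rewrite -monotone_convergence//.
- apply: eq_integral => x _; apply/cvg_lim => //.
  by apply: cvgeZr => //; exact: cvg_nnsfun_approx.
- move=> n; apply: emeasurable_funM => //; apply/measurable_EFinP.
  exact: measurableT_comp.
- by move=> n x _; rewrite mule_ge0// lee_fin.
- move=> x _ m n mn; rewrite lee_wpmul2r ?lee_fin//; exact: hnd.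
Qed.

End image_density.

Section perturbation.
Local Open Scope ereal_scope.
Context d (T : measurableType d) {R : realType}.

(** The sum mu + s is known to be nonnegative on measurable sets only, whereas
    a measure is nonnegative on every set; the maximum with 0 repairs this
    without changing the values that matter. The two hypotheses are arguments
    so that the measure structure can be attached to the function itself. *)
Definition perturb (mu : probability T R) (s : {charge set T -> \bar R})
    & s setT = 0 & (forall A, measurable A -> 0 <= mu A + s A) :=
  fun A : set T => maxe 0 (mu A + s A).

Variables (mu : probability T R) (s : {charge set T -> \bar R}).
Hypotheses (sT : s setT = 0)
  (mus_ge0 : forall A, measurable A -> 0 <= mu A + s A).

Local Notation nu := (perturb sT mus_ge0).

Lemma perturbE A : measurable A -> nu A = mu A + s A.
Proof. by move=> mA; apply/max_idPr; exact: mus_ge0. Qed.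

Let nu0 : nu set0 = 0.
Proof. by rewrite perturbE// measure0 charge0 adde0. Qed.

Let nu_ge0 A : 0 <= nu A.
Proof. by rewrite /perturb le_max lexx. Qed.

Let nu_sigma_additive : semi_sigma_additive nu.
Proof.
move=> F mF tF mUF; rewrite perturbE//.
under eq_cvg do under eq_bigr do rewrite perturbE//.
exact: (@charge_semi_sigma_additive _ _ _
  (cadd (charge_of_finite_measure mu) s) F mF tF mUF).
Qed.

HB.instance Definition _ :=
  isMeasure.Build _ _ _ nu nu0 nu_ge0 nu_sigma_additive.

Let nuT : nu setT = 1%:E.
Proof. by rewrite perturbE// sT adde0 probability_setT. Qed.

HB.instance Definition _ := Measure_isProbability.Build _ _ _ nu nuT.

Lemma exists_perturbed_probability :
  exists nu : probability T R, forall A, measurable A -> nu A = mu A + s A.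
Proof. by exists nu => A mA; exact: perturbE. Qed.

End perturbation.

Section image_charge.
Local Open Scope ereal_scope.
Context d1 d2 (T1 : measurableType d1) (T2 : measurableType d2) {R : realType}.
Variables (mu : {measure set T1 -> \bar R}) (phi : T1 -> T2).
Hypothesis mphi : measurable_fun setT phi.

Lemma exists_image_charge (f : T1 -> \bar R) : mu.-integrable setT f ->
  exists s : {charge set T2 -> \bar R},
    forall A, s A = \int[mu]_(x in phi @^-1` A) f x.
Proof.
move=> fi.
unshelve refine (ex_intro _
  (pushforward (induced_charge fi) phi : {charge set T2 -> \bar R}) _).
  exact: mphi.
by [].
Qed.

Lemma exists_image_measure (f : T1 -> \bar R) : mu.-integrable setT f ->
  (forall x, 0 <= f x) ->
  exists la : {measure set T2 -> \bar R},
    forall A, la A = \int[mu]_(x in phi @^-1` A) f x.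
Proof.
move=> fi f0; have [s sE] := exists_image_charge fi.
have s0 A : 0 <= s A by rewrite sE; apply: integral_ge0.
by exists (measure_of_charge s s0).
Qed.

End image_charge.

Section moment_on_halfline.
Context {R : realType}.
Implicit Types mu : probability R R.

Lemma supported_ae mu : supported_on_nonneg mu -> {ae mu, forall x, 0 <= x}.
Proof.
move=> mu1; exists (~` `[0, +oo[%classic); split.
- exact: measurableC.
- rewrite probability_setC// mu1 subee//.
- by move=> x /= /negP; rewrite in_itv/= andbT => /negP.
Qed.

Lemma moment_normr mu k : supported_on_nonneg mu ->
  moment mu k = (\int[mu]_x (`|x| ^+ k)%:E)%E.
Proof.
move=> /supported_ae mu1; apply: ae_eq_integral => //.
- by apply/measurable_EFinP; exact: exprn_measurable.
- by apply/measurable_EFinP; apply: measurable_funX; exact: normr_measurable.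
- by apply: filterS mu1 => x x0 _; rewrite ger0_norm.
Qed.

End moment_on_halfline.

Lemma sin_natpi {R : realType} k : sin (k%:R * pi) = 0 :> R.
Proof.
elim: k => [|k IH]; first by rewrite mul0r sin0.
by rewrite -natr1 mulrDl mul1r sinDpi IH oppr0.
Qed.

(** * Damped sines and indeterminacy *)

(** The decay rate and the frequency are written rho cos(th) and rho sin(th),
    that is, they are the coordinates of a point of the complex plane in polar
    form. Differentiating the exponential and the sine together then multiplies by
    - rho and shifts the phase by - th. *)
Section damped_sine.
Context {R : realType}.
Local Notation leb := (@lebesgue_measure R).
Variables (rho th : R).
Hypotheses (rho_gt0 : 0 < rho) (costh_gt0 : 0 < cos th).

Let a := rho * cos th.
Let b := rho * sin th.

Let a_gt0 : 0 < a. Proof. by rewrite mulr_gt0. Qed.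

Definition damped_sine (j : nat) (phi u : R) : R :=
  u ^+ j * expR (- (rho * cos th * u)) * sin (rho * sin th * u + phi).

Lemma is_derive_damped_sine j phi u :
  is_derive u (1 : R) (damped_sine j phi)
    (j%:R * damped_sine j.-1 phi u - rho * damped_sine j (phi - th) u).
Proof.
have dphase : is_derive u (1 : R) (fun y => b * y + phi) b.
  rewrite -[X in is_derive _ _ _ X]addr0.
  exact: (is_derive_addf (is_derive_linear b u) (is_derive_cst phi u 1)).
have dF := is_derive_mulf
  (is_derive_mulf (is_derive_monomial j u) (is_derive_expN a u))
  (is_derive_sinf dphase).
apply: (is_derive_eq dF).
rewrite /damped_sine -/a -/b addrA sinB.
by rewrite /a /b; ring.
Qed.

Lemma continuous_damped_sine j phi : continuous (damped_sine j phi).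
Proof. exact: (is_derive_continuous (is_derive_damped_sine j phi)). Qed.

Lemma measurable_damped_sine j phi : measurable_fun [set: R] (damped_sine j phi).
Proof. by apply: continuous_measurable_fun; exact: continuous_damped_sine. Qed.

Lemma damped_sine_le j phi u : 0 <= u ->
  `|damped_sine j phi u| <= u ^+ j * expR (- (a * u)).
Proof.
move=> u0; rewrite normrM ger0_norm ?mulr_ge0 ?exprn_ge0 ?expR_ge0//.
by rewrite ler_piMr ?sin_max// mulr_ge0 ?exprn_ge0 ?expR_ge0.
Qed.

Lemma integrable_damped_sine j phi :
  leb.-integrable `[0%R, +oo[ (EFin \o damped_sine j phi).
Proof.
apply: le_integrable (integrable_monomial_expN j a_gt0) => //.
  apply/measurable_EFinP; apply: measurable_funTS.
  exact: measurable_damped_sine.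
move=> x /=; rewrite in_itv/= andbT => x0; rewrite lee_fin.
by rewrite [leRHS]ger0_norm ?damped_sine_le// mulr_ge0 ?exprn_ge0 ?expR_ge0.
Qed.

Lemma cvgn_damped_sine j phi : damped_sine j phi n%:R @[n --> \oo] --> (0 : R).
Proof.
apply: norm_cvg0.
apply: (@squeeze_cvgr _ _ _ _ (fun=> 0)
  (fun n => n%:R ^+ j * expR (- (a * n%:R)))); last 2 first.
- exact: cvg_cst.
- exact: cvgn_monomial_expN.
- by apply: nearW => n; rewrite normr_ge0 damped_sine_le.
Qed.

(** The derivative of the damped sine of phase phi is integrated over the
    half-line, where it vanishes at infinity. *)
Lemma integral_damped_sine_rec j phi :
  j%:R * \int[leb]_(u in `[0%R, +oo[) damped_sine j.-1 phi u
  - rho * \int[leb]_(u in `[0%R, +oo[) damped_sine j (phi - th) u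
  = - damped_sine j phi 0.
Proof.
have i1 := integrable_damped_sine j.-1 phi.
have i2 := integrable_damped_sine j (phi - th).
rewrite -RintegralZl// -RintegralZl// -RintegralB//; last 2 first.
- exact: Rintegrable_scale.
- exact: Rintegrable_scale.
rewrite -[RHS]add0r.
apply: (@FTC_halfline _ _ (damped_sine j phi)).
- by move=> x; apply: cvgB; apply: cvgMr; exact: continuous_damped_sine.
- exact: is_derive_damped_sine.
- by apply: Rintegrable_sub => //; exact: Rintegrable_scale.
- exact: cvgn_damped_sine.
Qed.

(** This is the imaginary part of the Gamma integral of
    u ^ j exp(- rho e^(- i th) u + i phi), whose value is
    j! / rho ^ (j + 1) times e^(i (phi + (j + 1) th)); the induction on j
    avoids complex integration. *)
Lemma integral_damped_sine j phi :
  \int[leb]_(u in `[0%R, +oo[) damped_sine j phi u =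
  j`!%:R / rho ^+ j.+1 * sin (phi + j.+1%:R * th).
Proof.
have rho_neq0 : rho != 0 by rewrite gt_eqF.
elim: j phi => [|j IH] phi; rewrite -[phi](addrK th).
  have := integral_damped_sine_rec 0 (phi + th).
  rewrite mul0r sub0r {2}/damped_sine expr0 mulr0 oppr0 expR0 mulr1 mul1r mulr0 add0r.
  move/oppr_inj => E; rewrite fact0 expr1 !mul1r subrK -E.
  by field.
have := integral_damped_sine_rec j.+1 (phi + th).
rewrite {3}/damped_sine expr0n/= !mul0r oppr0 => /eqP; rewrite subr_eq0 => /eqP.
rewrite IH addrK => E.
apply: (mulfI rho_neq0); rewrite -E factS natrM !exprS.
have -> : phi + th + j.+1%:R * th = phi + j.+2%:R * th.
  by rewrite -[j.+2%:R]natr1; ring.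
field; by rewrite ?expf_neq0 ?rho_neq0.
Qed.

End damped_sine.

(** The law mu dominates the image under u |-> u ^ n of the measure with density
    c u ^ (n - 1) exp(- a u) on the half-line; in the variable x = u ^ n this
    is, up to a constant, the density exp(- a x ^ (1 / n)). *)
Definition stretched_minorant {R : realType} (n : nat) (c a : R)
    (mu : probability R R) : Prop :=
  forall A : set R, measurable A ->
    (\int[lebesgue_measure]_(u in `[0%R, +oo[ `&` (fun u => u ^+ n)%R @^-1` A)
       (c * (u ^+ n.-1 * expR (- (a * u))))%:E <= mu A)%E.

(** A function that oscillates inside the density of the minorant and is
    orthogonal to all the powers u ^ (n k). The angle is th = pi / n: the
    integral of u ^ (n k + n - 1) exp(- a u) sin(b u), with b / a = tan th, is
    a multiple of sin(n (k + 1) th), which is 0. The angle has to be less than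
    pi / 2, and this is where 3 <= n enters. *)
Section oscillating_kernel.
Context {R : realType}.
Local Notation leb := (@lebesgue_measure R).
Variables (n : nat) (c a : R).
Hypotheses (n_ge3 : (3 <= n)%N) (c_gt0 : 0 < c) (a_gt0 : 0 < a).

Let th : R := pi / n%:R.

Let n_gt0 : 0 < n%:R :> R. Proof. by rewrite ltr0n (leq_trans _ n_ge3). Qed.

Let th_gt0 : 0 < th. Proof. by rewrite divr_gt0// pi_gt0. Qed.

Let th_lt : th < pi / 2.
Proof.
by rewrite ltr_pM2l ?pi_gt0// ltf_pV2 ?posrE// ltr_nat (leq_trans _ n_ge3).
Qed.

Let costh_gt0 : 0 < cos th.
Proof. by apply: cos_gt0_pihalf; rewrite th_lt andbT (lt_trans _ th_gt0)// oppr_lt0 divr_gt0// pi_gt0. Qed.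

Let sinth_gt0 : 0 < sin th.
Proof. by apply: sin_gt0_pihalf; rewrite th_gt0. Qed.

Let rho : R := a / cos th.

Let rho_gt0 : 0 < rho. Proof. by rewrite divr_gt0. Qed.

Let rho_cos : rho * cos th = a. Proof. by rewrite divfK// gt_eqF. Qed.

Let b : R := rho * sin th.

Let b_gt0 : 0 < b. Proof. by rewrite mulr_gt0. Qed.

Definition kernel (u : R) : R := c * damped_sine rho th n.-1 0 u.

Lemma measurable_kernel : measurable_fun setT kernel.
Proof. by apply: measurable_funM => //; exact: measurable_damped_sine. Qed.

Lemma kernel_le u : 0 <= u -> `|kernel u| <= c * (u ^+ n.-1 * expR (- (a * u))).
Proof.
move=> u0; rewrite normrM gtr0_norm// ler_wpM2l ?(ltW c_gt0)//.
by rewrite (le_trans (damped_sine_le _ _ _ _ u0))// rho_cos.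
Qed.

Let kernel_powE k u : u ^+ n ^+ k * kernel u =
  c * damped_sine rho th (n * k + n.-1) 0 u.
Proof. by rewrite -exprM /kernel /damped_sine exprD; ring. Qed.

Lemma integrable_kernel_pow k :
  leb.-integrable `[0%R, +oo[ (EFin \o (fun u => u ^+ n ^+ k * kernel u)).
Proof.
rewrite (funext (kernel_powE k)).
by apply: Rintegrable_scale => //; exact: integrable_damped_sine.
Qed.

Lemma integral_kernel_pow k :
  (\int[leb]_(u in `[0%R, +oo[) (u ^+ n ^+ k * kernel u)%:E = 0)%E.
Proof.
rewrite -[LHS]fineK; last exact: integrable_fin_num (integrable_kernel_pow k).
congr EFin; rewrite -[LHS]/(\int[leb]_(u in `[0%R, +oo[) _).
under eq_Rintegral do rewrite kernel_powE.
rewrite RintegralZl//; last exact: integrable_damped_sine.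
rewrite integral_damped_sine// add0r.
have -> : (n * k + n.-1).+1%:R * th = k.+1%:R * pi.
  rewrite -addnS prednK ?(leq_trans _ n_ge3)// -mulnSr natrM /th.
  by field; rewrite gt_eqF.
by rewrite sin_natpi !mulr0.
Qed.

(** A positive integral over one block suffices to see that the perturbed law
    differs from the initial one. *)
Lemma kernel_positive_block : exists e k : R, [/\ 0 < e, 0 < k &
  forall u, e <= u <= 2 * e -> k <= kernel u].
Proof.
(* For u between e and 2 e the phase b u runs from pi / 4 to pi / 2, where the
   sine increases from a positive value. *)
pose e := pi / (4 * b).
have b4 : 0 < 4 * b by rewrite mulr_gt0.
have e0 : 0 < e by rewrite divr_gt0 ?pi_gt0.
exists e, (c * (e ^+ n.-1 * expR (- (a * (2 * e))) * sin (b * e))); split => //.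
  rewrite !mulr_gt0 ?exprn_gt0 ?expR_gt0//.
  have -> : b * e = pi / 4 by rewrite /e; field; rewrite gt_eqF.
  by apply: sin_gt0_pihalf; have := pi_gt0 R; lra.
move=> u /andP[eu u2e]; have u0 : 0 <= u by rewrite (le_trans _ eu)// ltW.
have be : b * e = pi / 4 by rewrite /e; field; rewrite gt_eqF.
have beu : b * e <= b * u by rewrite ler_pM2l.
have bu2 : b * u <= pi / 2.
  have : b * u <= b * (2 * e) by rewrite ler_pM2l.
  by rewrite mulrCA be; lra.
have pi0 := pi_gt0 R.
rewrite ler_pM2l// /damped_sine rho_cos -/b addr0.
apply: ler_pM.
- by rewrite mulr_ge0 ?exprn_ge0 ?expR_ge0// ltW.
- by rewrite ltW// sin_gt0_pihalf//; lra.
- apply: ler_pM; rewrite ?exprn_ge0 ?expR_ge0 ?(ltW e0)//.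
    by rewrite lerXn2r ?nnegrE// ltW.
  by rewrite ler_expR lerN2 ler_pM2l.
- rewrite le_eqVlt; case: (eqVneq (b * e) (b * u)) => [->|ne]; first by rewrite eqxx.
  rewrite ltr_sin ?orbT// ?in_itv/=; [|lra|lra].
  by rewrite lt_neqAle ne beu orbT.
Qed.

End oscillating_kernel.

Section nonuniqueness.
Context {R : realType}.
Local Notation TR := (measurableTypeR R).
Local Notation leb := (@lebesgue_measure R).

Lemma funrpos_scale (x y : R) : 0 <= x -> Num.max (x * y) 0 = x * Num.max y 0.
Proof. by move=> x0; rewrite maxr_pMr// mulr0. Qed.

Lemma integral_funrpos_eq_funrneg d (T : measurableType d)
    (m : {measure set T -> \bar R}) (D : set T) (f : T -> R) : measurable D ->
  m.-integrable D (EFin \o f) -> (\int[m]_(x in D) (f x)%:E = 0)%E ->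
  (\int[m]_(x in D) (f^\+%R x)%:E = \int[m]_(x in D) (f^\-%R x)%:E)%E.
Proof.
move=> mD fi.
have fp := integrable_fin_num mD (integrable_funrpos mD fi).
have fn := integrable_fin_num mD (integrable_funrneg mD fi).
rewrite integralE funerpos funerneg => /eqP.
by rewrite sube_eq ?fin_num_adde_defl// add0e => /eqP.
Qed.

(** The image of the kernel under u |-> u ^ n is a charge of total mass 0 that is
    bounded below by - mu and has all its moments equal to 0. Adding it to mu
    gives another probability measure on the half-line with the same
    moments. *)
Theorem stretched_minorant_not_unique (n : nat) (c a : R)
    (mu : probability R R) : (3 <= n)%N -> 0 < c -> 0 < a ->
  supported_on_nonneg mu -> stretched_minorant n c a mu ->
  ~ stieltjes_unique mu.
Proof.
move=> n3 c0 a0 smu lb uniq.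
have n0 : (0 < n)%N by rewrite (leq_trans _ n3).
pose phi : TR -> R := fun u => u ^+ n.
have mphi : measurable_fun [set: TR] phi by exact: (@exprn_measurable R setT n).
pose D : set TR := `[0%R, +oo[%classic.
have mD : measurable D by exact: measurable_itv.
have D_ge0 u : D u -> 0 <= u by rewrite /D/= in_itv/= andbT.
have mpre (A : set R) : measurable A -> measurable (phi @^-1` A).
  by move=> mA; rewrite -[X in measurable X]setTI; exact: mphi.
pose K : TR -> R := kernel n c a.
pose K0 : TR -> R := K \_ D.
have KE : (fun u => u ^+ n ^+ 0 * K u) = K.
  by apply/funext => u; rewrite expr0 mul1r.
have iK : leb.-integrable D (EFin \o K).
  by have := integrable_kernel_pow c n3 a0 0; rewrite KE.
have iK0 : leb.-integrable setT (EFin \o K0).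
  by have := (integrable_mkcond _ mD).1 iK; rewrite restrict_EFin.
have [s sE] := exists_image_charge mphi iK0.
have sDE A : s A = (\int[leb]_(u in D `&` phi @^-1` A) (K u)%:E)%E.
  by rewrite sE /K0 -restrict_EFin -integral_mkcondr setIC.
have sT : s setT = 0%E.
  rewrite sDE preimage_setT setIT -(integral_kernel_pow c n3 a0 0).
  by apply: eq_integral => u _; rewrite expr0 mul1r.
have mus_ge0 (A : set R) : measurable A -> (0 <= mu A + s A)%E.
  move=> mA; apply: (@le_trans _ _ (\int[leb]_(u in D `&` phi @^-1` A)
    ((c * (u ^+ n.-1 * expR (- (a * u))))%:E + (K u)%:E))%E).
    apply: integral_ge0 => u [/D_ge0 u0 _].
    rewrite -EFinD lee_fin -lerBlDr sub0r.
    by rewrite lerNl; have := kernel_le a n3 c0 u0; rewrite ler_norml => /andP[].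
  have mB : measurable (D `&` phi @^-1` A) by apply: measurableI => //; exact: mpre.
  rewrite integralD//.
  - by rewrite sDE leeD2r//; exact: lb.
  - apply: (integrableS mD mB (@subIsetl _ _ _)).
    exact: (Rintegrable_scale mD c (integrable_monomial_expN _ a0)).
  - exact: (integrableS mD mB (@subIsetl _ _ _)).
have [nu nuE] := exists_perturbed_probability sT mus_ge0.
have sD : s `[0%R, +oo[%classic = 0%E.
  rewrite sDE -sT sDE; congr (integral _ _ _).
  rewrite preimage_setT setIT; apply: setIidl => u /D_ge0 u0.
  by rewrite /= in_itv/= andbT exprn_ge0.
have snu : supported_on_nonneg nu.
  by rewrite /supported_on_nonneg nuE// sD adde0.
have mnu k : moment nu k = moment mu k.
  (* A charge has no integral, so its moments are computed on the images lp and
     ln of the positive and negative parts of the kernel, which satisfy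
     nu + ln = mu + lp. *)
  rewrite !moment_normr//.
  have p0 u : (0 <= K0^\+ u)%R by rewrite /funrpos le_max lexx orbT.
  have q0 u : (0 <= K0^\- u)%R by rewrite /funrneg le_max lexx orbT.
  have iK0p := integrable_funrpos measurableT iK0.
  have iK0n := integrable_funrneg measurableT iK0.
  have [lp lpE] := exists_image_measure mphi iK0p (fun u => p0 u).
  have [ln lnE] := exists_image_measure mphi iK0n (fun u => q0 u).
  pose F (x : R) := (`|x| ^+ k)%:E.
  have mF : measurable_fun [set: R] F.
    apply/measurable_EFinP; apply: measurable_funX; exact: normr_measurable.
  have F0 x : (0 <= F x)%E by rewrite lee_fin exprn_ge0.
  have addE : (\int[measure_add nu ln]_x F x = \int[measure_add mu lp]_x F x)%E.
    apply: eq_measure_integral => A mA _.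
    have iKA := integrableS measurableT (mpre _ mA) (@subsetT _ _) iK0.
    have fn := integrable_fin_num (mpre _ mA) (integrable_funrneg (mpre _ mA) iKA).
    transitivity (nu A + ln A)%E; first exact: measure_addE.
    transitivity (mu A + lp A)%E; last exact/esym/measure_addE.
    rewrite nuE// -addeA; congr (_ + _)%E.
    rewrite sE lnE lpE integralE funerpos funerneg.
    by rewrite subeK.
  move: addE; rewrite !ge0_integral_measure_add//.
  have imgp : (\int[lp]_x F x = \int[leb]_u (F (phi u) * (K0^\+ u)%:E))%E.
    apply: ge0_integral_image_density => //.
    by have /measurable_EFinP := measurable_int _ iK0p.
  have imgn : (\int[ln]_x F x = \int[leb]_u (F (phi u) * (K0^\- u)%:E))%E.
    apply: ge0_integral_image_density => //.
    by have /measurable_EFinP := measurable_int _ iK0n.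
  pose H0 : TR -> R := (fun u => u ^+ n ^+ k * K u) \_ D.
  have iH0 : leb.-integrable setT (EFin \o H0).
    have := (integrable_mkcond _ mD).1 (integrable_kernel_pow c n3 a0 k).
    by rewrite restrict_EFin.
  have H00 : (\int[leb]_u (H0 u)%:E = 0)%E.
    rewrite -(integral_kernel_pow c n3 a0 k) [RHS]integral_mkcond.
    by rewrite -[RHS]/(\int[leb]_u ((EFin \o _) \_ _) u)%E restrict_EFin.
  have HpE u : (F (phi u) * (K0^\+ u)%:E = (H0^\+%R u)%:E)%E.
    rewrite /F /phi /funrpos /H0 /K0 !patchE; case: ifPn => [|_].
      rewrite inE => /D_ge0 u0.
      by rewrite -EFinM ger0_norm ?exprn_ge0// [in RHS]funrpos_scale ?exprn_ge0.
    by rewrite (_ : Num.max _ _ = 0) ?mule0//; exact: maxxx.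
  have HnE u : (F (phi u) * (K0^\- u)%:E = (H0^\-%R u)%:E)%E.
    rewrite /F /phi /funrneg /H0 /K0 !patchE; case: ifPn => [|_].
      rewrite inE => /D_ge0 u0.
      by rewrite -EFinM ger0_norm ?exprn_ge0// -[in RHS]mulrN [in RHS]funrpos_scale ?exprn_ge0.
    by rewrite oppr0 (_ : Num.max _ _ = 0) ?mule0//; exact: maxxx.
  have fH := integrable_fin_num measurableT (integrable_funrneg measurableT iH0).
  rewrite imgp imgn (eq_integral _ _ (fun u _ => HpE u)).
  rewrite (eq_integral _ _ (fun u _ => HnE u)).
  rewrite (integral_funrpos_eq_funrneg measurableT iH0 H00).
  by move=> /(congr1 (fun z => z - \int[leb]_u (H0^\-%R u)%:E)%E); rewrite !addeK.
(* The image of the block on which the kernel is positive separates the two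
   measures. *)
have [e [k [e0 k0 kK]]] := kernel_positive_block n3 c0 a0.
pose A : set R := `[e ^+ n, (2 * e) ^+ n]%classic.
have mA : measurable A by exact: measurable_itv.
have AE : D `&` phi @^-1` A = `[e, 2 * e]%classic.
  apply/seteqP; split=> u.
    move=> [/D_ge0 u0]; rewrite /A/= !in_itv/=.
    by rewrite !ler_pXn2r// ?nnegrE ?mulr_ge0// ltW.
  rewrite /A/= in_itv/= => /andP[eu ue].
  have u0 : 0 <= u by rewrite (le_trans _ eu)// ltW.
  split; first by rewrite /D/= in_itv/= u0.
  by rewrite /= in_itv/= !ler_pXn2r ?eu ?ue// ?nnegrE ?mulr_ge0// ltW.
have s_gt0 : (0 < s A)%E.
  rewrite sDE AE; apply: (@lt_le_trans _ _ (\int[leb]_(u in `[e, (2 * e)%R]) k%:E)%E).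
    rewrite integral_cst//= lebesgue_measure_itv/= lte_fin ifT; last by lra.
    by rewrite -EFinD -EFinM lte_fin mulr_gt0//; lra.
  apply: ge0_le_integral => //.
  - by move=> u _; rewrite lee_fin ltW.
  - apply/measurable_EFinP; apply: measurable_funTS.
    exact: measurable_kernel.
have := uniq nu snu mnu A mA; rewrite nuE// => E.
move: s_gt0; have muA : mu A \is a fin_num by exact: fin_num_measure.
by rewrite -(addeK (s A) muA) [(s A + _)%E]addeC E subee// ltxx.
Qed.

End nonuniqueness.

(** * Multiplicative convolution with the half-logistic law *)

Section ray_uniqueness.
Context {R : realType}.

Lemma left_ray_measure_unique
    (m1 m2 : {measure set (measurableTypeR R) -> \bar R}) :
  (forall x : R, m1 `]-oo, x[%classic = m2 `]-oo, x[%classic) ->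
  (forall x : R, (m1 `]-oo, x[%classic < +oo)%E) ->
  forall A, measurable A -> m1 A = m2 A.
Proof.
move=> m12 m1fin A mA.
apply: (@measure_unique _ _ (measurableTypeR R) (@RGenInftyO.G R)
  (fun n => `]-oo, n%:R[%classic) _ _ _ _ m1 m2) => //.
- exact: RGenInftyO.measurableE.
- move=> _ _ [x ->] [y ->]; exists (Num.min x y).
  by apply/seteqP; split=> z; rewrite /= !in_itv/= lt_min => /andP.
- by move=> n; exists n%:R.
- apply/seteqP; split=> // x _; exists (Num.truncn `|x|).+1 => //=.
  by rewrite in_itv/= (le_lt_trans (ler_norm x))// truncnS_gt.
- by move=> _ [x ->]; exact: m12.
Qed.

Lemma right_ray_probability_unique (m1 m2 : probability R R) :
  (forall x : R, m1 `]x, +oo[%classic = m2 `]x, +oo[%classic) ->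
  forall A, measurable A -> m1 A = m2 A.
Proof.
move=> m12 A mA.
apply: (@measure_unique _ _ R (@RGenOInfty.G R)
  (fun n => `]- n%:R, +oo[%classic) _ _ _ _ m1 m2) => //.
- exact: RGenOInfty.measurableE.
- move=> _ _ [x ->] [y ->]; exists (Num.max x y).
  by apply/seteqP; split=> z; rewrite /= !in_itv/= !andbT gt_max => /andP.
- by move=> n; exists (- n%:R).
- apply/seteqP; split=> // x _; exists (Num.truncn `|x|).+1 => //=.
  rewrite in_itv/= andbT ltrNl (le_lt_trans (ler_norm (- x)))//.
  by rewrite normrN truncnS_gt.
- by move=> _ [x ->]; exact: m12.
- by move=> k; rewrite (le_lt_trans (probability_le1 _ _)) ?ltry.
Qed.

End ray_uniqueness.

(** The substitution x = k u ^ (n + 1) on the half-line, for nonnegative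
    measurable integrands. Lebesgue measure restricted to the half-line and the
    image la of the density k (n + 1) u ^ n agree on left rays by the
    fundamental theorem of calculus, hence are equal. *)
Section power_substitution.
Context {R : realType}.
Local Notation TR := (measurableTypeR R).
Local Notation leb := (@lebesgue_measure R).

Lemma exists_nneg_root n (x : R) : 0 <= x -> exists2 y : R, 0 <= y & y ^+ n.+1 = x.
Proof.
move=> x0; exists (x `^ n.+1%:R^-1); first exact: powR_ge0.
by rewrite -powR_mulrn ?powR_ge0// -powRrM mulVf ?pnatr_eq0// powRr1.
Qed.

Variables (n : nat) (k : R).
Hypothesis k_gt0 : 0 < k.

Let D : set TR := `[0%R, +oo[%classic.
Let mD : measurable D. Proof. exact: measurable_itv. Qed.
Let phi : TR -> TR := fun u => k * u ^+ n.+1.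
Let mphi : measurable_fun setT phi.
Proof. by apply: (@measurable_funM _ _ R) => //; exact: exprn_measurable. Qed.
Let g0 : R -> R := fun u => k * (n.+1%:R * u ^+ n).
Let cg0 : continuous g0.
Proof.
by move=> u; apply: cvgMr; apply: cvgMr; exact: exprn_continuous.
Qed.
Let g : TR -> R := g0 \_ D.
Let g_ge0 u : 0 <= g u.
Proof.
rewrite /g patchE; case: ifPn => // /set_mem; rewrite /D/= in_itv/= andbT => u0.
by rewrite /g0 !mulr_ge0 ?exprn_ge0// ltW.
Qed.
Let mg : measurable_fun setT g.
Proof.
apply/(measurable_restrictT _ mD); apply: measurable_funTS.
exact: continuous_measurable_fun.
Qed.

Let la (A : set TR) : \bar R := (\int[leb]_(u in phi @^-1` A) (g u)%:E)%E.
Let laDE A : la A = (\int[leb]_(u in phi @^-1` A `&` D) (g0 u)%:E)%E.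
Proof.
by rewrite integral_mkcondr; apply: eq_integral => u _; rewrite restrict_EFin.
Qed.
Let la0 : la set0 = 0%E. Proof. by rewrite /la preimage_set0 integral_set0. Qed.
Let la_ge0 A : (0 <= la A)%E.
Proof. by apply: integral_ge0 => u _; rewrite lee_fin. Qed.
Let la_sigma_additive : semi_sigma_additive la.
Proof.
move=> F mF tF mUF; rewrite /la preimage_bigcup.
have mpre A : measurable A -> measurable (phi @^-1` A).
  by move=> mA; rewrite -[X in measurable X]setTI; exact: mphi.
apply: (semi_sigma_additive_nng_induced (f := EFin \o g)).
- exact/measurable_EFinP.
- by move=> u; rewrite lee_fin.
- by move=> i; exact: mpre.
- apply/trivIsetP => /= i j _ _ ij; rewrite -preimage_setI.
  by move/trivIsetP : tF => /(_ _ _ _ _ ij) ->//; rewrite preimage_set0.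
- by rewrite -preimage_bigcup; exact: mpre.
Qed.
HB.instance Definition _ := isMeasure.Build _ _ _ la la0 la_ge0 la_sigma_additive.

Let la_ray (x : R) : la `]-oo, x[%classic = mrestr leb mD `]-oo, x[%classic.
Proof.
rewrite laDE /mrestr.
have [x0|x0] := ltP 0 x; last first.
  rewrite (_ : _ `&` _ = set0) ?integral_set0; last first.
    apply/seteqP; split=> // u [] /=; rewrite /D/= !in_itv/= andbT /phi => + u0.
    by rewrite ltNge (le_trans x0)// mulr_ge0 ?exprn_ge0// ltW.
  rewrite (_ : _ `&` _ = set0) ?measure0//.
  apply/seteqP; split=> // u [] /=; rewrite /D/= !in_itv/= andbT => + u0.
  by rewrite ltNge (le_trans x0).
have xk : 0 <= x / k by rewrite divr_ge0// ltW.
have [y y0 yE] := exists_nneg_root n xk.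
have y_gt0 : 0 < y.
  rewrite lt_neqAle y0 andbT; apply/negP => /eqP y00; move: yE.
  by rewrite -y00 expr0n/= => /esym/eqP; rewrite gt_eqF// divr_gt0.
rewrite (_ : _ `&` _ = `[0, y[%classic); last first.
  apply/seteqP; split=> u /=; rewrite /D/= !in_itv/= andbT /phi.
    by move=> [+ u0]; rewrite mulrC -ltr_pdivlMr// -yE ltr_pXn2r// u0.
  move=> /andP[u0 uy]; split => //.
  by rewrite mulrC -ltr_pdivlMr// -yE ltr_pXn2r.
rewrite (_ : _ `&` _ = `[0, x[%classic); last first.
  apply/seteqP; split=> u /=; rewrite /D/= !in_itv/= andbT.
    by move=> [ux u0]; rewrite u0.
  by move=> /andP[u0 ux].
rewrite lebesgue_measure_itv/= lte_fin x0 sube0.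
rewrite integral_itv_bndo_bndc; last first.
  apply/measurable_EFinP; apply: measurable_funTS.
  exact: continuous_measurable_fun.
have dF u : is_derive u (1 : R) (fun v => k * v ^+ n.+1) (g0 u).
  have := is_derive_compf (is_derive_linear k _) (is_derive_monomial n.+1 u).
  exact.
by rewrite (FTC_itv cg0 dF)//= yE expr0n/= mulr0 subr0 mulrCA divff ?mulr1// gt_eqF.
Qed.

Lemma integral_power_substitution (F : R -> \bar R) :
  measurable_fun [set: R] F -> (forall x, (0 <= F x)%E) ->
  (\int[leb]_(x in `[0%R, +oo[) F x =
   \int[leb]_(u in `[0%R, +oo[)
     (F (k * u ^+ n.+1)%R * (k * (n.+1%:R * u ^+ n))%:E))%E.
Proof.
move=> mF F0.
have laE A : measurable A -> mrestr leb mD A = la A.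
  move=> mA; apply/esym; apply: (@left_ray_measure_unique R la (mrestr leb mD)) => // x.
  rewrite [X in (X < _)%E]la_ray /mrestr.
  apply: (@le_lt_trans _ _ (leb `[0, `|x|]%classic)); last first.
    by rewrite lebesgue_measure_itv/= lte_fin; case: ifP => _; rewrite ?sube0 ltry.
  apply: le_measure; rewrite ?inE.
  - by apply: measurableI.
  - exact: measurable_itv.
  - move=> u [] /=; rewrite /D/= !in_itv/= andbT => ux ->/=.
    by rewrite (le_trans (ltW ux))// ler_norm.
transitivity (\int[mrestr leb mD]_x F x)%E.
  rewrite (@ge0_integral_image_density _ _ _ _ _ leb _ id \1_D)//.
  - rewrite [LHS]integral_mkcond; apply: eq_integral => x _.
    by rewrite epatch_indic.
  - by move=> A mA; rewrite integral_indic// setIC.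
rewrite (ge0_integral_image_density mphi mg g_ge0 laE)//.
rewrite [RHS]integral_mkcond; apply: eq_integral => u _.
by rewrite /g !patchE; case: ifPn => // _; exact: mule0.
Qed.

End power_substitution.

Section half_logistic_facts.
Context {R : realType}.
Local Notation leb := (@lebesgue_measure R).

Definition has_half_logistic_density (la : probability R R) : Prop := forall A : set R, measurable A ->
  la A = (\int[leb]_(x in A) (half_logistic_pdf x)%:E)%E.

Lemma half_logistic_pdf_ge0 (x : R) : 0 <= half_logistic_pdf x.
Proof.
rewrite /half_logistic_pdf; case: ifP => [_|//].
by rewrite divr_ge0 ?mulr_ge0 ?expR_ge0// exprn_ge0// addr_ge0 ?expR_ge0.
Qed.

(** On the half-line the denominator of the density lies between 1 and 4. *)
Lemma half_logistic_pdf_lower (x : R) : 0 <= x ->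
  2^-1 * expR (- (1 * x)) <= half_logistic_pdf x.
Proof.
move=> x0; rewrite /half_logistic_pdf x0 mul1r.
have e0 := expR_gt0 (- x).
have e1 : expR (- x) <= 1 by rewrite expR_le1 oppr_le0.
rewrite ler_pdivlMr ?exprn_gt0 ?addr_gt0//.
have : (1 + expR (- x)) ^+ 2 <= 4 by rewrite expr2; nra.
by move=> ?; nra.
Qed.

Lemma half_logistic_pdf_upper (x : R) : 0 <= x ->
  half_logistic_pdf x <= 2 * expR (- (1 * x)).
Proof.
move=> x0; rewrite /half_logistic_pdf x0 mul1r.
have e0 := expR_gt0 (- x).
rewrite ler_pdivrMr ?exprn_gt0 ?addr_gt0// expr2.
have : 0 <= expR (- x) * (2 + expR (- x)) by nra.
by move=> ?; nra.
Qed.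

Lemma measurable_half_logistic_pdf :
  measurable_fun [set: R] (@half_logistic_pdf R).
Proof.
apply: measurable_fun_ifT.
- by apply: measurable_fun_ler.
- apply: continuous_measurable_fun => x.
  have cexp : continuous (fun y : R => expR (- y)).
    by move=> y; apply: continuous_comp; [exact: continuousN|exact: continuous_expR].
  apply: cvgM; first by apply: cvgMr; exact: cexp.
  apply: cvgV; first by rewrite sqrf_eq0 gt_eqF// addr_gt0 ?expR_gt0.
  apply: (@cvg_comp _ _ _ _ (fun y : R => y ^+ 2)); last exact: exprn_continuous.
  by apply: cvgD; [exact: cvg_cst|exact: cexp].
- exact: measurable_cst.
Qed.

End half_logistic_facts.

Section product_law.
Context {R : realType}.
Implicit Types mu nu la : probability R R.

(** The law of y x, where y has law mu, x has law nu, and they are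
    independent. *)
Definition mult_conv mu nu (A : set R) : \bar R :=
  (\int[nu]_x mu ((fun y => y * x)%R @^-1` A))%E.

Lemma measurable_mult_section mu (A : set R) : measurable A ->
  measurable_fun [set: R] (fun x => mu ((fun y => y * x) @^-1` A)).
Proof.
move=> mA; pose B := (fun z : R * R => z.2 * z.1) @^-1` A.
have mB : measurable B.
  rewrite -[B]setTI.
  have mf : measurable_fun [set: R * R] (fun z : R * R => z.2 * z.1).
    by apply: measurable_funM; [exact: measurable_snd|exact: measurable_fst].
  exact: mf.
have := measurable_fun_xsection mu mB.
congr (measurable_fun _ _); apply/funext => x /=; congr (mu _).
by apply/seteqP; split=> y; rewrite /xsection/= inE.
Qed.

End product_law.

(** If mu has a minorant of exponent n = m + 1, the multiplicative convolution of
    mu with the half-logistic law has one of exponent n + 1. By the lower bounds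
    on both factors the convolution dominates the image of the density
    c u ^ (n - 1) exp(- a u) exp(- x) / 2 under (u, x) |-> u ^ n x. The
    substitution x = v ^ (n + 1) / u ^ n turns the product into v ^ (n + 1) and
    the density into
      (c / 2) (n + 1) (v ^ n / u) exp(- a u - v ^ (n + 1) / u ^ n).
    For u between v and 2 v one has v / u >= 1 / 2, a u <= 2 a v and
    v ^ (n + 1) / u ^ n <= v, so this is at least
    c (n + 1) / 4 v ^ (n - 1) exp(- (2 a + 1) v), and integrating over this
    window of length v gives the missing factor v. *)
Section minorant_product.
Context {R : realType}.
Local Notation TR := (measurableTypeR R).
Local Notation leb := (@lebesgue_measure R).
Variables (mu la : probability R R) (m : nat) (c a : R).
Hypotheses (c_gt0 : 0 < c) (a_gt0 : 0 < a).
Hypothesis mu_minorant : stretched_minorant m.+1 c a mu.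
Hypothesis la_density : has_half_logistic_density la.
Variables (A : set R).
Hypothesis mA : measurable A.

Let D : set TR := `[0%R, +oo[%classic.
Let mD : measurable D. Proof. exact: measurable_itv. Qed.
Let E : set TR := `]0%R, +oo[%classic.
Let mE : measurable E. Proof. exact: measurable_itv. Qed.
Let DE u : D u = (0 <= u) :> Prop. Proof. by rewrite /D/= in_itv/= andbT. Qed.
Let EE u : E u = (0 < u) :> Prop. Proof. by rewrite /E/= in_itv/= andbT. Qed.

(* The minorants of the two factors, the integrand I in the variables (u, x)
   that they give, and the integrand J in the variables (u, v) that is left
   after the substitution and the restriction to the window v <= u <= 2 v. *)
Let w (u : TR) : R := c * (u ^+ m * expR (- (a * u))) * \1_D u.
Let h (x : TR) : R := 2^-1 * expR (- (1 * x)) * \1_D x.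
Let I (z : TR * TR) : R := \1_A (z.1 ^+ m.+1 * z.2) * w z.1 * h z.2.
Let c' : R := c * m.+2%:R / 4.
Let a' : R := 2 * a + 1.
Let J (z : TR * TR) : R := \1_A (z.2 ^+ m.+2) *
  (c' * (z.2 ^+ m * expR (- (a' * z.2)))) *
  (\1_D (z.1 - z.2) * \1_D (2 * z.2 - z.1) * \1_E z.1).

Let w_ge0 u : 0 <= w u.
Proof.
rewrite /w indicE; case: (boolP (u \in D)) => [/set_mem|]; rewrite ?mulr0//.
by rewrite DE mulr1 => u0; rewrite !mulr_ge0 ?exprn_ge0 ?expR_ge0// ltW.
Qed.

Let h_ge0 x : 0 <= h x.
Proof. by rewrite /h !mulr_ge0 ?expR_ge0// invr_ge0. Qed.

Let I_ge0 z : 0 <= I z.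
Proof. by rewrite /I; apply: mulr_ge0 => //; apply: mulr_ge0. Qed.

Let c'_gt0 : 0 < c'. Proof. by rewrite !mulr_gt0// invr_gt0. Qed.

Let J_ge0 z : 0 <= J z.
Proof.
rewrite /J; have [z0|z0] := leP 0 (z.2).
  by rewrite !mulr_ge0 ?exprn_ge0 ?expR_ge0// ltW.
rewrite [X in _ * X](_ : _ = 0) ?mulr0//.
rewrite !indicE; case: (boolP (_ \in D)) => [/set_mem|]; last by rewrite !mul0r.
rewrite DE => z1; case: (boolP (_ \in D)) => [/set_mem|]; last by rewrite mulr0 mul0r.
rewrite DE => z2; have key (p q : R) : 0 <= p - q -> 0 <= 2 * q - p -> 0 <= q.
  by lra.
by have := key _ _ z1 z2; rewrite leNgt z0.
Qed.

Let mw : measurable_fun setT w.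
Proof.
apply: measurable_funM; last exact: measurable_indic.
by apply: measurable_funM => //; exact: measurable_monomial_expN.
Qed.

Let mh : measurable_fun setT h.
Proof.
apply: measurable_funM; last exact: measurable_indic.
by apply: measurable_funM => //; exact: measurable_expN.
Qed.

Let mindic (B : set TR) (f : TR * TR -> TR) : measurable B ->
  measurable_fun setT f -> measurable_fun setT (fun z => \1_B (f z) : R).
Proof. by move=> mB mf; exact: (measurableT_comp (@measurable_indic _ TR R setT B mB) mf). Qed.

Let mI : measurable_fun setT I.
Proof.
apply: measurable_funM; last exact: (measurableT_comp mh measurable_snd).
apply: measurable_funM; last exact: (measurableT_comp mw measurable_fst).
have mz : measurable_fun setT (fun z : TR * TR => z.1 ^+ m.+1 * z.2).
  apply: (@measurable_funM _ _ R); last exact: measurable_snd.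
  by apply: measurable_funX; exact: measurable_fst.
exact: (mindic mA mz).
Qed.

Let mJ : measurable_fun setT J.
Proof.
have m1 := @measurable_fst _ _ TR TR.
have m2 := @measurable_snd _ _ TR TR.
apply: measurable_funM; first apply: measurable_funM.
- have mz : measurable_fun setT (fun z : TR * TR => z.2 ^+ m.+2).
    exact: (@measurable_funX _ _ R).
  exact: (mindic mA mz).
- apply: measurable_funM => //.
  exact: (measurableT_comp (measurable_monomial_expN m a') m2).
- apply: measurable_funM; last exact: (mindic mE m1).
  apply: measurable_funM.
  + have mz : measurable_fun setT (fun z : TR * TR => z.1 - z.2).
      exact: (@measurable_funB _ _ R).
    exact: (mindic mD mz).
  + have mz : measurable_fun setT (fun z : TR * TR => 2 * z.2 - z.1).
      by apply: (@measurable_funB _ _ R) => //; exact: (@measurable_funM _ _ R).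
    exact: (mindic mD mz).
Qed.

Let mEI : measurable_fun setT (EFin \o I). Proof. exact/measurable_EFinP. Qed.
Let EI0 z : (0 <= (EFin \o I) z)%E. Proof. by rewrite lee_fin. Qed.
Let mEJ : measurable_fun setT (EFin \o J). Proof. exact/measurable_EFinP. Qed.
Let EJ0 z : (0 <= (EFin \o J) z)%E. Proof. by rewrite lee_fin. Qed.

Let sectionE x : (\int[leb]_u (I (u, x))%:E =
  (\int[leb]_(u in D `&` (fun u => u ^+ m.+1)%R @^-1` ((fun y => y * x)%R @^-1` A))
    (c * (u ^+ m * expR (- (a * u))))%:E) * (h x)%:E)%E.
Proof.
have mB : measurable (D `&` (fun u => u ^+ m.+1)%R @^-1` ((fun y => y * x)%R @^-1` A)).
  apply: measurableI => //; have mf : measurable_fun [set: R] (fun u => u ^+ m.+1 * x).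
    by apply: measurable_funM => //; exact: exprn_measurable.
  by have := mf measurableT A mA; rewrite setTI.
rewrite -ge0_integralZr//; last 3 first.
- apply/measurable_EFinP; apply: measurable_funM => //.
  by apply: measurable_funTS; exact: measurable_monomial_expN.
- move=> u [u0 _]; move: u0; rewrite DE => u0.
  by rewrite lee_fin !mulr_ge0 ?exprn_ge0 ?expR_ge0// ltW.
- by rewrite lee_fin.
rewrite [RHS]integral_mkcond; apply: eq_integral => u _.
rewrite patchE in_setI /I /w/= !indicE.
rewrite (_ : (u \in (fun u => u ^+ m.+1) @^-1` _) = (u ^+ m.+1 * x \in A)); last first.
  by apply/idP/idP => /set_mem H; apply/mem_set; exact: H.
by case: (u \in D); case: (_ \in A); rewrite /= ?mulr1 ?mulr0 ?mul0r ?mul1r ?EFinM.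
Qed.

Let section_lower_bound : (\int[leb]_x \int[leb]_u (I (u, x))%:E <= mult_conv mu la A)%E.
Proof.
rewrite /mult_conv.
have mG : measurable_fun [set: TR] (fun x => mu ((fun y => y * x) @^-1` A)).
  exact: (measurable_mult_section mu mA).
have mf : measurable_fun [set: TR] (EFin \o @half_logistic_pdf R).
  by apply/measurable_EFinP; exact: (@measurable_half_logistic_pdf R).
rewrite (@ge0_integral_image_density _ _ _ _ _ leb la id (@half_logistic_pdf R))//.
- apply: ge0_le_integral => //.
  + by move=> x _; apply: integral_ge0 => u _; rewrite lee_fin.
  + exact: (measurable_fun_fubini_tonelli_G _ mEI EI0).
  + exact: (emeasurable_funM mG mf).
  + move=> x _; rewrite sectionE /=.
    have [x0|x0] := leP 0 x; last first.
      rewrite /h indicE memNset ?DE; last by apply/negP; rewrite -ltNge.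
      by rewrite mulr0 mule0 mule_ge0 ?lee_fin ?half_logistic_pdf_ge0.
    apply: lee_pmul; rewrite ?lee_fin ?h_ge0//.
    - apply: integral_ge0 => u [u0 _]; move: u0; rewrite DE => u0.
      by rewrite lee_fin !mulr_ge0 ?exprn_ge0 ?expR_ge0// ltW.
    - apply: mu_minorant.
      have mf' : measurable_fun [set: R] (fun y => y * x) by exact: measurable_funM.
      by rewrite -[X in measurable X]setTI; exact: mf'.
    - by rewrite /h indicE mem_set ?DE// mulr1; exact: half_logistic_pdf_lower.
- exact: measurable_half_logistic_pdf.
- exact: half_logistic_pdf_ge0.
Qed.

Let windowE (u v : R) : \1_D (u - v) * \1_D (2 * v - u) * \1_E u =
  [&& 0 < u, v <= u & u <= 2 * v]%:R :> R.
Proof.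
have memD x : (x \in D) = (0 <= x).
  by apply/idP/idP => [/set_mem|x0]; rewrite ?DE//; apply/mem_set; rewrite DE.
have memE x : (x \in E) = (0 < x).
  by apply/idP/idP => [/set_mem|x0]; rewrite ?EE//; apply/mem_set; rewrite EE.
rewrite !indicE !memD memE !subr_ge0.
by case: (0 < u); case: (v <= u); case: (u <= 2 * v); rewrite /= ?mulr1 ?mulr0 ?mul0r.
Qed.

Let window_gt0 (u v : R) : 0 < u -> u <= 2 * v -> 0 < v.
Proof. by move=> u0 u2v; lra. Qed.

Let pointwise_bound (u v : R) : 0 < u -> v <= u -> u <= 2 * v ->
  c' * (v ^+ m * expR (- (a' * v))) <=
  c * (u ^+ m * expR (- (a * u))) *
    (2^-1 * expR (- (1 * ((u ^+ m.+1)^-1 * v ^+ m.+2)))) *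
    ((u ^+ m.+1)^-1 * (m.+2%:R * v ^+ m.+1)).
Proof.
move=> u0 vu u2v; have v0 : 0 < v by lra.
have um0 : u ^+ m != 0 by rewrite expf_neq0// gt_eqF.
have -> : c * (u ^+ m * expR (- (a * u))) *
    (2^-1 * expR (- (1 * ((u ^+ m.+1)^-1 * v ^+ m.+2)))) *
    ((u ^+ m.+1)^-1 * (m.+2%:R * v ^+ m.+1)) =
  c * m.+2%:R / 4 * (v ^+ m * (2 * v / u) *
    expR (- (a * u) - (u ^+ m.+1)^-1 * v ^+ m.+2)).
  rewrite expRD mul1r !exprS; field.
  by rewrite um0 gt_eqF.
rewrite ler_pM2l//; apply: ler_pM; rewrite ?exprn_ge0 ?expR_ge0 ?(ltW v0)//.
  by rewrite ler_peMr ?exprn_ge0 ?(ltW v0)// ler_pdivlMr// mul1r.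
rewrite ler_expR /a' mulrDl mul1r opprD lerD ?lerN2//.
  by rewrite [2 * a]mulrC -mulrA ler_pM2l.
rewrite [v ^+ m.+2]exprS mulrCA ler_piMr ?(ltW v0)//.
rewrite mulrC ler_pdivrMr ?exprn_gt0// mul1r.
by rewrite lerXn2r// nnegrE ltW.
Qed.

Let substitution_lower_bound u : (\int[leb]_v (J (u, v))%:E <= \int[leb]_x (I (u, x))%:E)%E.
Proof.
have [u0|u0] := leP u 0.
  rewrite integral0_eq; first by apply: integral_ge0 => x _; rewrite lee_fin.
  move=> v _; rewrite /J/= [\1_E u]indicE memNset ?mulr0//.
  by rewrite EE; apply/negP; rewrite -leNgt.
pose F (x : R) : \bar R := (\1_A (u ^+ m.+1 * x) * (c * (u ^+ m * expR (- (a * u)))) *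
  (2^-1 * expR (- (1 * x))))%:E.
have F0 x : (0 <= F x)%E.
  by rewrite lee_fin !mulr_ge0 ?exprn_ge0 ?expR_ge0 ?invr_ge0// ltW.
have mF : measurable_fun [set: R] F.
  apply/measurable_EFinP; apply: measurable_funM; last first.
    by apply: measurable_funM => //; exact: measurable_expN.
  apply: measurable_funM => //.
  have mz : measurable_fun [set: R] (fun x => u ^+ m.+1 * x) by exact: measurable_funM.
  exact: (measurableT_comp (@measurable_indic _ R R setT A mA) mz).
have -> : (\int[leb]_x (I (u, x))%:E = \int[leb]_(x in `[0%R, +oo[) F x)%E.
  rewrite [RHS]integral_mkcond; apply: eq_integral => x _.
  rewrite patchE /I /w /h/= [\1_D u]indicE mem_set ?DE ?(ltW u0)// mulr1.
  rewrite [\1_D x]indicE.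
  by rewrite -/D; case: (x \in D); rewrite ?mulr1 ?mulr0.
rewrite (@integral_power_substitution _ m.+1 (u ^+ m.+1)^-1)//; last first.
  by rewrite invr_gt0 exprn_gt0.
rewrite [leRHS]integral_mkcond; apply: ge0_le_integral => //.
- by move=> v _; rewrite lee_fin.
- exact: (measurableT_comp mEJ (measurable_pair1 _)).
- apply: (measurable_restrictT _ mD).1; apply: measurable_funTS.
  have mk : measurable_fun [set: R] (fun v => (u ^+ m.+1)^-1 * v ^+ m.+2).
    by apply: measurable_funM => //; exact: exprn_measurable.
  have mg : measurable_fun [set: R]
      (fun v => ((u ^+ m.+1)^-1 * (m.+2%:R * v ^+ m.+1))%:E).
    apply/measurable_EFinP; apply: measurable_funM => //.
    by apply: measurable_funM => //; exact: exprn_measurable.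
  exact: (emeasurable_funM (measurableT_comp mF mk) mg).
move=> v _; rewrite /J/= windowE.
case: (boolP [&& _, _ & _]) => [/and3P[_ vu u2v]|_] /=; last first.
  rewrite mulr0 patchE; case: ifPn => // /set_mem; rewrite /= in_itv/= andbT => v0.
  apply: mule_ge0 => //; rewrite lee_fin !mulr_ge0 ?exprn_ge0// invr_ge0 exprn_ge0//.
  exact: ltW.
have v0 := window_gt0 u0 u2v.
rewrite patchE mem_set/= ?in_itv/= ?(ltW v0)// lee_fin mulr1.
rewrite mulVKf; last by rewrite expf_neq0// gt_eqF.
rewrite -!mulrA ler_wpM2l//.
by have := pointwise_bound u0 vu u2v; rewrite -!mulrA.
Qed.

Let integral_window v : (\int[leb]_u (J (u, v))%:E = (\1_A (v ^+ m.+2) *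
  (c' * (v ^+ m.+1 * expR (- (a' * v)))) * \1_D v)%:E)%E.
Proof.
have [v0|v0] := leP v 0.
  transitivity (0 : \bar R)%E.
    apply: integral0_eq => u _; congr EFin; rewrite /J/= windowE.
    case: (boolP [&& _, _ & _]) => [/and3P[u0 vu u2v]|_]; last by rewrite mulr0.
    by have := window_gt0 u0 u2v; rewrite ltNge v0.
  congr EFin; have [->|vn0] := eqVneq v 0.
    by rewrite [0 ^+ m.+1]expr0n/= mul0r mulr0 mulr0 mul0r.
  rewrite [\1_D v]indicE memNset ?mulr0// DE; apply/negP; rewrite -ltNge.
  by rewrite lt_neqAle vn0.
transitivity (\int[leb]_u ((\1_A (v ^+ m.+2) *
  (c' * (v ^+ m * expR (- (a' * v)))))%:E * (\1_(`[v, 2 * v]%classic) u)%:E))%E.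
  apply: eq_integral => u _; rewrite -EFinM; congr EFin; rewrite /J/=; congr (_ * _).
  rewrite windowE indicE; congr (_%:R); congr nat_of_bool.
  apply/and3P/idP => [[u0 vu u2v]|].
    by apply/mem_set; rewrite /= in_itv/= vu.
  move=> /set_mem; rewrite /= in_itv/= => /andP[vu u2v]; split => //.
  exact: lt_le_trans vu.
rewrite ge0_integralZl//; last 2 first.
- by apply/measurable_EFinP; exact: measurable_indic.
- by rewrite lee_fin !mulr_ge0 ?exprn_ge0 ?expR_ge0 ?(ltW v0)// ltW.
rewrite integral_indic// setIT/= lebesgue_measure_itv/= lte_fin ifT; last by rewrite mulr_natl mulr2n ltrDl.
rewrite -EFinD -EFinM; congr EFin.
rewrite [\1_D v]indicE mem_set ?DE ?(ltW v0)// mulr1.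
have -> : 2 * v - v = v by ring.
have key (p q r s t : R) : p * (q * (r * s)) * t = p * (q * (r * t * s)) by ring.
by rewrite [v ^+ m.+1]exprSr; exact: key.
Qed.

Lemma minorant_mult_conv_set :
  (\int[leb]_(u in `[0%R, +oo[ `&` (fun u => u ^+ m.+2)%R @^-1` A)
       (c * m.+2%:R / 4 * (u ^+ m.+1 * expR (- ((2 * a + 1) * u))))%:E
    <= mult_conv mu la A)%E.
Proof.
apply: le_trans section_lower_bound.
rewrite -(fubini_tonelli _ mEI EI0).
apply: (@le_trans _ _ (\int[leb]_u \int[leb]_v (J (u, v))%:E)%E).
  rewrite (fubini_tonelli _ mEJ EJ0).
  under [leRHS]eq_integral do rewrite integral_window.
  rewrite [leLHS]integral_mkcond le_eqVlt; apply/orP; left; apply/eqP.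
  apply: eq_integral => v _; rewrite patchE in_setI -/D.
  rewrite (_ : (v \in (fun u => u ^+ m.+2) @^-1` _) = (v ^+ m.+2 \in A)); last first.
    by apply/idP/idP => /set_mem H; apply/mem_set; exact: H.
  rewrite !indicE.
  by case: (v \in D); case: (_ \in A); rewrite /= ?mulr1 ?mulr0 ?mul0r ?mul1r.
apply: ge0_le_integral => //.
- by move=> u _; apply: integral_ge0 => v _; rewrite lee_fin.
- exact: (measurable_fun_fubini_tonelli_F _ mEJ EJ0).
- exact: (measurable_fun_fubini_tonelli_F _ mEI EI0).
Qed.

End minorant_product.

Section mult_conv_theory.
Context {R : realType}.
Implicit Types mu la : probability R R.

Definition is_mult_conv mu la (nu : probability R R) : Prop :=
  forall A : set R, measurable A -> nu A = mult_conv mu la A.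

Lemma mult_convE mu la (A : set R) :
  mult_conv mu la A = (la \x mu)%E ((fun z : R * R => z.2 * z.1) @^-1` A).
Proof.
rewrite /mult_conv /product_measure1/=; apply: eq_integral => x _ /=.
by congr (mu _); apply/seteqP; split=> y; rewrite /xsection/= inE.
Qed.

(** A multiplicative convolution is the image of a product measure, so Tonelli's
    theorem applies. *)
Lemma ge0_integral_mult_conv mu la nu (F : R -> \bar R) :
  is_mult_conv mu la nu -> measurable_fun [set: R] F -> (forall x, (0 <= F x)%E) ->
  (\int[nu]_z F z = \int[la]_x \int[mu]_y F (y * x)%R)%E.
Proof.
move=> nuE mF F0.
pose phi (z : R * R) : R := z.2 * z.1.
have mphi : measurable_fun [set: R * R] phi.
  by apply: measurable_funM; [exact: measurable_snd|exact: measurable_fst].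
rewrite (@ge0_integral_image_density _ _ _ _ _ (la \x mu)%E nu phi (cst 1) mphi)//.
  under eq_integral do rewrite mule1.
  rewrite (fubini_tonelli1 (fun z => F (phi z)))//.
  exact: measurableT_comp.
move=> A mA; rewrite [LHS](nuE A mA) mult_convE.
rewrite -[LHS]mul1e; apply/esym; apply: (integral_cst _ _ 1%E).
by rewrite -[X in measurable X]setTI; exact: mphi.
Qed.

Lemma abs_moment_mult_conv mu la nu k : is_mult_conv mu la nu ->
  (\int[nu]_z (`|z| ^+ k)%:E =
   (\int[mu]_y (`|y| ^+ k)%:E) * (\int[la]_x (`|x| ^+ k)%:E))%E.
Proof.
move=> nuE; have mk : measurable_fun [set: R] (fun x : R => (`|x| ^+ k)%:E).
  by apply/measurable_EFinP; apply: measurable_funX; exact: normr_measurable.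
have k0 (x : R) : (0 <= (`|x| ^+ k)%:E)%E by rewrite lee_fin exprn_ge0.
rewrite (ge0_integral_mult_conv nuE)//.
rewrite -ge0_integralZl//; last exact: integral_ge0.
apply: eq_integral => x _; rewrite -ge0_integralZr//.
by apply: eq_integral => y _; rewrite normrM exprMn EFinM.
Qed.

Lemma supported_mult_conv mu la nu : is_mult_conv mu la nu ->
  supported_on_nonneg mu -> supported_on_nonneg la -> supported_on_nonneg nu.
Proof.
move=> nuE smu sla; rewrite /supported_on_nonneg nuE//.
transitivity (\int[la]_x (cst 1%E x : \bar R))%E; last first.
  by rewrite integral_cst// mul1e; exact: probability_setT.
apply: ae_eq_integral => //; first exact: measurable_mult_section.
apply: filterS (supported_ae sla) => x x0 _ /=.
apply/eqP; rewrite eq_le probability_le1/=; last first.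
  have mf : measurable_fun [set: R] (fun y => y * x) by exact: measurable_funM.
  by rewrite -[X in measurable X]setTI; exact: mf.
rewrite -smu le_measure// ?inE//.
  have mf : measurable_fun [set: R] (fun y => y * x) by exact: measurable_funM.
  by rewrite -[X in measurable X]setTI; exact: mf.
by move=> y; rewrite /= !in_itv/= !andbT => y0; exact: mulr_ge0.
Qed.

Lemma stretched_minorant_mult_conv mu la nu m c a : 0 < c -> 0 < a ->
  stretched_minorant m.+1 c a mu ->
  has_half_logistic_density la ->
  is_mult_conv mu la nu ->
  stretched_minorant m.+2 (c * m.+2%:R / 4) (2 * a + 1) nu.
Proof.
move=> c0 a0 mumin lad nuE A mA; rewrite nuE//.
exact: minorant_mult_conv_set.
Qed.

End mult_conv_theory.

(** * Products of independent variables *)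

Section independent_products.
Context d (T : measurableType d) (R : realType) (P : probability T R).
Variables (n : nat) (xis : 'I_n -> {RV P >-> R}).
Hypothesis hindep : mutually_independent xis.

(** The product of the first m variables, as a product over all indices filtered
    by i < m, which makes sense for every m. *)
Definition prefix_prod (m : nat) (t : T) : R := \prod_(i < n | (i < m)%N) xis i t.

Lemma measurable_prefix_prod m : measurable_fun setT (prefix_prod m).
Proof.
rewrite /prefix_prod; under eq_fun do rewrite big_mkcond.
by apply: measurable_prod => i _; case: (i < m)%N => //; exact: measurable_funPT.
Qed.

Definition prefix_RV m : {RV P >-> R} := mfun_Sub (mem_set (measurable_prefix_prod m)).

Local Notation law m := (distribution P (prefix_RV m)).

Lemma prefix_prod0 t : prefix_prod 0 t = 1.
Proof. by rewrite /prefix_prod big_pred0. Qed.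

Lemma prefix_prodS m (ltmn : (m < n)%N) t :
  prefix_prod m.+1 t = prefix_prod m t * xis (Ordinal ltmn) t.
Proof.
rewrite /prefix_prod (bigD1 (Ordinal ltmn))//= mulrC; congr (_ * _).
apply: eq_bigl => i; rewrite ltnS leq_eqVlt -val_eqE/=.
by case: ltngtP => //=; rewrite ?andbF.
Qed.

Lemma prefix_prod_all t : prefix_prod n t = \prod_(i < n) xis i t.
Proof. by rewrite /prefix_prod; apply: eq_bigl => i; rewrite ltn_ord. Qed.

Definition cylinder (J : {set 'I_n}) (B : 'I_n -> set R) : set T :=
  \bigcap_(i in [set` J]) (xis i @^-1` B i).

Lemma measurable_cylinder J B : (forall i, measurable (B i)) ->
  measurable (cylinder J B).
Proof.
move=> mB; apply: fin_bigcap_measurable; first exact: finite_finset.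
by move=> i _; exact: measurable_funPTI.
Qed.

Lemma probability_cylinder J B : (forall i, measurable (B i)) ->
  P (cylinder J B) = (\prod_(i in J) P (xis i @^-1` B i))%E.
Proof. exact: hindep. Qed.

Lemma cylinder_setU1 (J : {set 'I_n}) B (i0 : 'I_n) (C : set R) : i0 \notin J ->
  cylinder (i0 |: J) (fun i => if i == i0 then C else B i) =
  xis i0 @^-1` C `&` cylinder J B.
Proof.
move=> i0J; apply/seteqP; split=> t.
  move=> H; split; first by have := H i0; rewrite /= !inE eqxx => /(_ isT).
  move=> i iJ; have := H i; rewrite /= !inE iJ orbT => /(_ isT).
  by case: eqP iJ => // ->; rewrite /= (negbTE i0J).
move=> [tC tJ] i; rewrite /= !inE; case: eqP => [->//|_ /= iJ].
exact: tJ.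
Qed.

Let measurable_if (B : 'I_n -> set R) (i0 : 'I_n) (C : set R) :
  measurable C -> (forall i, measurable (B i)) ->
  forall i, measurable (if i == i0 then C else B i).
Proof. by move=> mC mB i; case: ifP. Qed.

Lemma probability_cylinder_setU1 (J : {set 'I_n}) B (i0 : 'I_n) (C : set R) : i0 \notin J ->
  measurable C -> (forall i, measurable (B i)) ->
  P (xis i0 @^-1` C `&` cylinder J B) =
  (P (xis i0 @^-1` C) * P (cylinder J B))%E.
Proof.
move=> i0J mC mB; rewrite -cylinder_setU1// !probability_cylinder//; last first.
  exact: measurable_if.
rewrite big_setU1//= eqxx; congr (_ * _)%E.
apply: eq_bigr => i iJ; case: eqP => // ii0.
by rewrite -ii0 iJ in i0J.
Qed.

(** Conditioning on the cylinder E of the later variables, the pair formed by the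
    new variable and the prefix product is distributed as the product of
    their laws: both measures agree on rectangles by the hypothesis applied to
    the set J enlarged by the new index. Multiplying the two coordinates then
    gives the multiplicative convolution. When E has probability 0 there is
    nothing to condition on, and both sides vanish. *)
Lemma prefix_law_indep_mult_conv m (ltmn : (m < n)%N) :
  (forall (J : {set 'I_n}) B (A : set R), (forall i, i \in J -> (m <= i)%N) ->
     (forall i, measurable (B i)) -> measurable A ->
     P (prefix_prod m @^-1` A `&` cylinder J B) =
     (P (prefix_prod m @^-1` A) * P (cylinder J B))%E) ->
  forall (J : {set 'I_n}) B (A : set R), (forall i, i \in J -> (m < i)%N) ->
     (forall i, measurable (B i)) -> measurable A ->
     P (prefix_prod m.+1 @^-1` A `&` cylinder J B) =
     (mult_conv (law m) (distribution P (xis (Ordinal ltmn))) A * P (cylinder J B))%E.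
Proof.
move=> IH J B A Jm mB mA.
pose i0 := Ordinal ltmn.
have i0J : i0 \notin J by apply/negP => /Jm; rewrite ltnn.
pose E := cylinder J B.
have mE : measurable E by exact: measurable_cylinder.
have mpre k (C : set R) : measurable C -> measurable (prefix_prod k @^-1` C).
  by move=> mC; have := measurable_prefix_prod k measurableT mC; rewrite setTI.
have [PE0|PE0] := eqVneq (P E) 0%E.
  rewrite PE0 mule0; apply/eqP; rewrite eq_le measure_ge0 andbT -PE0.
  by apply: le_measure; rewrite ?inE//; apply: measurableI => //; exact: mpre.
have PEfin : P E \is a fin_num by exact: fin_num_measure.
pose p := fine (P E).
have p0 : 0 < p by rewrite fine_gt0// lt0e PE0 measure_ge0/= ltey_eq PEfin.
pose phi (t : T) : R * R := (xis i0 t, prefix_prod m t).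
have mphi : measurable_fun setT phi.
  by apply: measurable_fun_pair; [exact: measurable_funPT|exact: measurable_prefix_prod].
pose f (t : T) : R := p^-1 * \1_E t.
have fi : P.-integrable setT (EFin \o f).
  by apply: Rintegrable_scale => //; exact: integrable_indic.
have f0 t : (0 <= (EFin \o f) t)%E by rewrite lee_fin mulr_ge0// invr_ge0 ltW.
have [cond condE] := exists_image_measure mphi fi f0.
have cond_setE C : measurable (phi @^-1` C) ->
    cond C = (p^-1%:E * P (phi @^-1` C `&` E))%E.
  move=> mC; rewrite condE /f /=.
  under eq_integral do rewrite EFinM.
  rewrite ge0_integralZl//; last 2 first.
  - by apply/measurable_EFinP; exact: measurable_indic.
  - by rewrite lee_fin invr_ge0 ltW.
  by rewrite integral_indic// setIC.
pose mul (z : R * R) : R := z.2 * z.1.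
have mmul : measurable_fun [set: R * R] mul.
  by apply: measurable_funM; [exact: measurable_snd|exact: measurable_fst].
have mmulA : measurable (mul @^-1` A) by have := mmul measurableT A mA; rewrite setTI.
have prodE : (distribution P (xis i0) \x law m)%E (mul @^-1` A) = cond (mul @^-1` A).
  apply: product_measure_unique => // C C' mC mC'.
  rewrite cond_setE; last first.
    by apply: measurableI; [exact: measurable_funPTI|exact: mpre].
  rewrite (_ : phi @^-1` (C `*` C') `&` E = prefix_prod m @^-1` C' `&`
    cylinder (i0 |: J) (fun i => if i == i0 then C else B i)); last first.
    rewrite cylinder_setU1// setIA; congr (_ `&` _).
    by apply/seteqP; split=> t [].
  rewrite IH//; last exact: measurable_if.
    rewrite cylinder_setU1// probability_cylinder_setU1// -/E.
    rewrite -(fineK PEfin) -/p muleC -!muleA -EFinM divff ?gt_eqF// mule1 muleC//.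
  by move=> i; rewrite !inE => /orP[/eqP ->//|/Jm/ltnW].
rewrite mult_convE prodE cond_setE; last first.
  by have := mphi measurableT _ mmulA; rewrite setTI.
rewrite muleAC -/E -(fineK PEfin) -/p -EFinM mulVf ?gt_eqF// mul1e.
congr (P (_ `&` _)); apply/seteqP; split=> t /=; by rewrite prefix_prodS.
Qed.

(** Independence is assumed for preimages under the single variables only. To
    pass it to products one factor at a time, the induction keeps track of the
    independence of the prefix product from all cylinders over later
    variables. *)
Lemma prefix_law_indep m : (m <= n)%N ->
  forall (J : {set 'I_n}) B (A : set R), (forall i, i \in J -> (m <= i)%N) ->
     (forall i, measurable (B i)) -> measurable A ->
     P (prefix_prod m @^-1` A `&` cylinder J B) =
     (P (prefix_prod m @^-1` A) * P (cylinder J B))%E.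
Proof.
elim: m => [_|m IH mn] J B A Jm mB mA.
  have [A1|A1] := pselect (A 1).
    rewrite (_ : prefix_prod 0 @^-1` A = setT) ?setTI ?probability_setT ?mul1e//.
    by apply/seteqP; split=> t //= _; rewrite prefix_prod0.
  rewrite (_ : prefix_prod 0 @^-1` A = set0) ?set0I ?measure0 ?mul0e//.
  by apply/seteqP; split=> t //=; rewrite prefix_prod0.
rewrite (prefix_law_indep_mult_conv mn)//; last exact: IH (ltnW mn).
congr (_ * _)%E.
have := prefix_law_indep_mult_conv mn (IH (ltnW mn)) (J := finset.set0) (B := fun=> setT) _ _ mA.
rewrite (_ : cylinder _ _ = setT) ?setIT ?probability_setT ?mule1; last first.
  by apply/seteqP; split=> // t _ i; rewrite /= inE.
by move=> ->// i; rewrite inE.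
Qed.

Lemma prefix_law_mult_conv m (ltmn : (m < n)%N) :
  is_mult_conv (law m) (distribution P (xis (Ordinal ltmn))) (law m.+1).
Proof.
move=> A mA; have := prefix_law_indep_mult_conv ltmn (prefix_law_indep (ltnW ltmn))
  (J := finset.set0) (B := fun=> setT) _ _ mA.
rewrite (_ : cylinder _ _ = setT) ?setIT ?probability_setT ?mule1; last first.
  by apply/seteqP; split=> // t _ i; rewrite /= inE.
by move=> <-// i; rewrite inE.
Qed.

End independent_products.

(** * Moments of the half-logistic law and laws of powers *)

Section half_logistic_law.
Context {R : realType}.
Local Notation leb := (@lebesgue_measure R).
Implicit Types mu la : probability R R.

Definition abs_moment mu (k : nat) : \bar R := (\int[mu]_x (`|x| ^+ k)%:E)%E.

Lemma measurable_abs_pow k : measurable_fun [set: R] (fun x : R => `|x| ^+ k).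
Proof. by apply: measurable_funX; exact: normr_measurable. Qed.

Lemma abs_moment_ge0 mu k : (0 <= abs_moment mu k)%E.
Proof. by apply: integral_ge0 => x _; rewrite lee_fin exprn_ge0. Qed.

Lemma finite_moments_abs mu :
  (forall k, (abs_moment mu k < +oo)%E) -> finite_moments mu.
Proof.
move=> mufin k; apply/integrableP; split.
  by apply/measurable_EFinP; exact: exprn_measurable.
by under eq_integral do rewrite /= normrX; exact: mufin.
Qed.

Lemma ge0_integral_half_logistic la (F : R -> \bar R) :
  has_half_logistic_density la ->
  measurable_fun [set: R] F -> (forall x, (0 <= F x)%E) ->
  (\int[la]_x F x = \int[leb]_(x in `[0%R, +oo[) (F x * (half_logistic_pdf x)%:E))%E.
Proof.
move=> lad mF F0.
rewrite (@ge0_integral_image_density _ _ _ _ _ leb la id (@half_logistic_pdf R))//.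
- rewrite [RHS]integral_mkcond; apply: eq_integral => x _; rewrite patchE.
  case: ifPn => // /negP xn; rewrite /half_logistic_pdf ifF ?mule0//.
  apply/negP => x0; apply: xn; apply/mem_set.
  by rewrite /= in_itv/= x0.
- exact: measurable_half_logistic_pdf.
- exact: half_logistic_pdf_ge0.
Qed.

Lemma half_logistic_supported la : has_half_logistic_density la ->
  supported_on_nonneg la.
Proof.
move=> lad; have := ge0_integral_half_logistic lad (measurable_cst 1%E) (fun=> lee01).
rewrite integral_cst// mul1e => laT.
rewrite /supported_on_nonneg lad//; transitivity (la setT); last exact: probability_setT.
by apply/esym; rewrite [LHS]laT; apply: eq_integral => x _; rewrite mul1e.
Qed.

(** The density is at most 2 exp(- x), and x ^ k exp(- x) is at most
    2 ^ k k! exp(- x / 2), whose integral is 2 ^ (k + 1) k!. *)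
Lemma half_logistic_abs_moment_le la k : has_half_logistic_density la ->
  (abs_moment la k <= (4 * 2 ^+ k * k`!%:R)%:E)%E.
Proof.
move=> lad; rewrite /abs_moment (ge0_integral_half_logistic lad); last 2 first.
- by apply/measurable_EFinP; exact: measurable_abs_pow.
- by move=> x; rewrite lee_fin exprn_ge0.
have half0 : 0 < 2^-1 :> R by rewrite invr_gt0.
have -> : (4 * 2 ^+ k * k`!%:R)%:E =
    ((2 * (2 ^+ k * k`!%:R))%:E * (2^-1^-1)%:E)%E :> \bar R.
  by rewrite -EFinM invrK; congr EFin; ring.
rewrite -(integral_expN half0) -ge0_integralZl//; last first.
  by apply/measurable_EFinP; apply: measurable_funTS; exact: measurable_expN.
apply: ge0_le_integral => //.
- by move=> x _; rewrite -EFinM lee_fin mulr_ge0 ?exprn_ge0// half_logistic_pdf_ge0.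
- apply: measurable_funTS; apply: emeasurable_funM.
    by apply/measurable_EFinP; exact: measurable_abs_pow.
  by apply/measurable_EFinP; exact: measurable_half_logistic_pdf.
- apply/measurable_EFinP; apply: measurable_funTS.
  by apply: measurable_funM => //; exact: measurable_expN.
move=> x; rewrite /= in_itv/= andbT => x0; rewrite -!EFinM lee_fin ger0_norm//.
apply: (@le_trans _ _ (x ^+ k * (2 * expR (- (1 * x))))).
  by rewrite ler_wpM2l ?exprn_ge0 ?half_logistic_pdf_upper.
rewrite mulrCA -mulrA ler_wpM2l//.
by have := monomial_expN_le k (@ltr01 R) x0; rewrite divr1 div1r.
Qed.

End half_logistic_law.

Section power_law.
Context {R : realType}.
Local Notation leb := (@lebesgue_measure R).
Implicit Types mu la : probability R R.

Definition is_power_law n la (nu : probability R R) : Prop :=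
  forall A : set R, measurable A -> nu A = la ((fun x => x ^+ n) @^-1` A).

Let mpow n : measurable_fun [set: R] (fun x : R => x ^+ n).
Proof. exact: exprn_measurable. Qed.

Let mpre n (A : set R) : measurable A -> measurable ((fun x : R => x ^+ n) @^-1` A).
Proof. by move=> mA; have := mpow n measurableT mA; rewrite setTI. Qed.

Lemma abs_moment_power_law n la nu k : is_power_law n la nu ->
  abs_moment nu k = abs_moment la (n * k).
Proof.
move=> nuE; rewrite /abs_moment.
rewrite (@ge0_integral_image_density _ _ _ _ _ la nu (fun x => x ^+ n) (cst 1))//.
- by apply: eq_integral => x _; rewrite mule1 normrX exprM.
- move=> A mA; rewrite [LHS](nuE A mA) -[LHS]mul1e; apply/esym.
  by apply: (integral_cst _ _ 1%E); exact: mpre.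
- by apply/measurable_EFinP; exact: measurable_abs_pow.
Qed.

Lemma supported_power_law n la nu : is_power_law n la nu ->
  supported_on_nonneg la -> supported_on_nonneg nu.
Proof.
move=> nuE sla; rewrite /supported_on_nonneg nuE//.
apply/eqP; rewrite eq_le probability_le1/=; last exact: mpre.
rewrite -sla le_measure// ?inE//; first exact: mpre.
by move=> x; rewrite /= !in_itv/= !andbT => x0; exact: exprn_ge0.
Qed.

(** The density of la is at least exp(- u) / 2, and the factor u ^ (n - 1)
    required by the shape of a minorant costs (n - 1)! exp u, which raises the
    rate from 1 to 2. *)
Lemma power_law_minorant n la nu : has_half_logistic_density la ->
  is_power_law n la nu -> stretched_minorant n (2^-1 / n.-1`!%:R) 2 nu.
Proof.
move=> lad nuE A mA; rewrite nuE// lad; last exact: mpre.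
have mB : measurable (`[0%R, +oo[ `&` (fun x : R => x ^+ n) @^-1` A).
  by apply: measurableI => //; exact: mpre.
apply: (@le_trans _ _ (\int[leb]_(u in `[0%R, +oo[ `&` (fun x : R => x ^+ n)%R @^-1` A)
    (half_logistic_pdf u)%:E)%E).
  apply: ge0_le_integral => //.
  - move=> u [+ _]; rewrite /= in_itv/= andbT => u0.
    by rewrite lee_fin !mulr_ge0 ?exprn_ge0 ?expR_ge0 ?invr_ge0.
  - apply/measurable_EFinP; apply: measurable_funTS; apply: measurable_funM => //.
    exact: measurable_monomial_expN.
  - apply/measurable_EFinP; apply: measurable_funTS.
    exact: measurable_half_logistic_pdf.
  - move=> u [+ _]; rewrite /= in_itv/= andbT => u0.
    rewrite lee_fin (le_trans _ (half_logistic_pdf_lower u0))//.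
    rewrite -mulrA ler_wpM2l ?invr_ge0// mulrC ler_pdivrMr ?ltr0n ?fact_gt0//.
    rewrite mul1r mulr_natl mulr2n opprD expRD mulrA mulrC ler_wpM2l ?expR_ge0//.
    by rewrite expRN ler_pdivrMr ?expR_gt0// pow_le_expR.
apply: ge0_subset_integral => //.
- exact: mpre.
- apply/measurable_EFinP; apply: measurable_funTS.
  exact: measurable_half_logistic_pdf.
- by move=> u _; rewrite lee_fin half_logistic_pdf_ge0.
Qed.

End power_law.

(** * Cosine transforms and moment growth *)

Section cosine_taylor.
Context {R : realType}.

Lemma le_of_derive_le (f g f' g' : R -> R) :
  (forall x, is_derive x (1 : R) f (f' x)) ->
  (forall x, is_derive x (1 : R) g (g' x)) ->
  f 0 = g 0 -> (forall x, 0 <= x -> f' x <= g' x) ->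
  forall x, 0 <= x -> f x <= g x.
Proof.
move=> df dg fg0 f'g' x; rewrite le_eqVlt => /predU1P[<-|x0]; first by rewrite fg0.
have dh y : is_derive y (1 : R) (fun y => g y - f y) (g' y - f' y).
  exact: is_derive_subf.
have ch : {within `[0, x], continuous (fun y => g y - f y)}.
  exact: (continuous_subspaceT (is_derive_continuous dh)).
have [c] := MVT x0 (fun y _ => dh y) ch.
rewrite in_itv/= => /andP[c0 _]; rewrite fg0 subrr subr0 => gfE.
by rewrite -subr_ge0 gfE mulr_ge0 ?subr_ge0 ?(ltW x0)// f'g'// ltW.
Qed.

Lemma norm_le_of_derive_le (f g f' g' : R -> R) :
  (forall x, is_derive x (1 : R) f (f' x)) ->
  (forall x, is_derive x (1 : R) g (g' x)) ->
  f 0 = 0 -> g 0 = 0 -> (forall x, 0 <= x -> `|f' x| <= g' x) ->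
  forall x, 0 <= x -> `|f x| <= g x.
Proof.
move=> df dg f0 g0 f'g' x x0; rewrite ler_norml; apply/andP; split.
- rewrite lerNl; apply: (@le_of_derive_le (fun y => - f y) g (fun y => - f' y) g') => //.
  + by rewrite f0 g0 oppr0.
  + by move=> y y0; rewrite lerNl; have := f'g' y y0; rewrite ler_norml => /andP[].
- apply: (@le_of_derive_le f g f' g') => //; first by rewrite f0 g0.
  by move=> y y0; have := f'g' y y0; rewrite ler_norml => /andP[].
Qed.

(** The j-th derivative of the cosine. *)
Definition dcos (j : nat) (x : R) : R := cos (x + j%:R * (pi / 2)).

Lemma dcos0 x : dcos 0 x = cos x.
Proof. by rewrite /dcos mul0r addr0. Qed.

Lemma dcosS j x : dcos j.+1 x = - sin (x + j%:R * (pi / 2)).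
Proof. by rewrite /dcos -natr1 mulrDl mul1r addrA cosDpihalf. Qed.

Lemma dcos_odd0 j : odd j -> dcos j 0 = 0.
Proof.
move=> oj; rewrite -[j]odd_double_half oj add1n dcosS add0r.
rewrite (_ : _ * _ = j./2%:R * pi); first by rewrite sin_natpi oppr0.
by rewrite -muln2 natrM; field.
Qed.

Lemma norm_dcos_le1 j x : `|dcos j x| <= 1.
Proof. exact: cos_max. Qed.

Lemma is_derive_shift (p x : R) : is_derive x (1 : R) (fun y => p + y) 1.
Proof.
rewrite -[X in is_derive _ _ _ X]add0r.
exact: (is_derive_addf (is_derive_cst p x 1) (is_derive_id x 1)).
Qed.

Lemma is_derive_dcos j p x : is_derive x (1 : R) (fun y => dcos j (p + y)) (dcos j.+1 (p + x)).
Proof.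
rewrite dcosS -mulN1r.
apply: (@is_derive_cosf _ (fun y => p + y + j%:R * (pi / 2))).
rewrite -[X in is_derive _ _ _ X]addr0.
exact: (is_derive_addf (is_derive_shift p x) (is_derive_cst _ x 1)).
Qed.

Lemma is_derive_sumf N (h : nat -> R -> R) (h' : nat -> R) x :
  (forall i, is_derive x (1 : R) (h i) (h' i)) ->
  is_derive x (1 : R) (fun y => \sum_(i < N) h i y) (\sum_(i < N) h' i).
Proof.
move=> dh; elim: N => [|N IH].
  rewrite big_ord0 (_ : (fun _ => _) = cst 0); first exact: is_derive_cst.
  by apply/funext => y; rewrite big_ord0.
rewrite big_ord_recr (_ : (fun _ => _) = (fun y => \sum_(i < N) h i y + h N y)).
  exact: is_derive_addf.
by apply/funext => y; rewrite big_ord_recr.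
Qed.

Lemma is_derive_divided_pow i x :
  is_derive x (1 : R) (fun y => y ^+ i.+1 / i.+1`!%:R) (x ^+ i / i`!%:R).
Proof.
have := is_derive_mulf (is_derive_monomial i.+1 x) (is_derive_cst (i.+1`!%:R^-1 : R) x 1).
rewrite mulr0 addr0 /= => h; apply: (is_derive_eq h).
rewrite factS natrM invfM mulrACA divff ?pnatr_eq0// mul1r.
by [].
Qed.

(** Taylor's inequality, with constant 1 since all the derivatives of the cosine
    are bounded by 1. By induction on the order: the derivative in q of the
    remainder is a remainder of smaller order for the next derivative. *)
Lemma dcos_taylor N j p q : 0 <= q ->
  `|dcos j (p + q) - \sum_(i < N) q ^+ i / i`!%:R * dcos (i + j) p| <= q ^+ N / N`!%:R.
Proof.
elim: N j q => [|N IH] j q q0.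
  by rewrite big_ord0 subr0 expr0 fact0 divr1 norm_dcos_le1.
pose f y := dcos j (p + y) - (dcos j p + \sum_(i < N) y ^+ i.+1 / i.+1`!%:R * dcos (i.+1 + j) p).
pose f' y := dcos j.+1 (p + y) - (0 + \sum_(i < N) y ^+ i / i`!%:R * dcos (i.+1 + j) p).
have fE y : dcos j (p + y) - \sum_(i < N.+1) y ^+ i / i`!%:R * dcos (i + j) p = f y.
  by rewrite big_ord_recl expr0 fact0 divr1 mul1r.
have dsum x : is_derive x (1 : R)
    (fun y => \sum_(i < N) y ^+ i.+1 / i.+1`!%:R * dcos (i.+1 + j) p)
    (\sum_(i < N) x ^+ i / i`!%:R * dcos (i.+1 + j) p).
  apply: (@is_derive_sumf N (fun i y => y ^+ i.+1 / i.+1`!%:R * dcos (i.+1 + j) p)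
    (fun i => x ^+ i / i`!%:R * dcos (i.+1 + j) p)) => i.
  have := is_derive_mulf (is_derive_divided_pow i x) (is_derive_cst (dcos (i.+1 + j) p) x 1).
  by rewrite mulr0 addr0.
have df x : is_derive x (1 : R) f (f' x).
  exact: (is_derive_subf (is_derive_dcos j p x)
    (is_derive_addf (is_derive_cst (dcos j p) x 1) (dsum x))).
have f0 : f 0 = 0.
  rewrite /f addr0 big1 ?addr0 ?subrr// => i _.
  by rewrite expr0n/= !mul0r.
have g0 : 0 ^+ N.+1 / N.+1`!%:R = 0 :> R by rewrite expr0n/= mul0r.
have f'le x : 0 <= x -> `|f' x| <= x ^+ N / N`!%:R.
  move=> x0; have := IH j.+1 x x0; rewrite /f' add0r.
  by under eq_bigr do rewrite addnS -addSn.
rewrite fE.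
exact: (norm_le_of_derive_le df (is_derive_divided_pow N) f0 g0 f'le).
Qed.

End cosine_taylor.

Section moment_growth.
Context {R : realType}.
Implicit Types mu nu : probability R R.
Local Notation rt := (@Num.sqrt R).

(** Hardy's growth condition: it bounds the even moments of the square root of
    the variable as for an exponential law. *)
Definition moment_growth (C b : R) mu : Prop := forall k,
  (abs_moment mu k <= (C * b ^+ (2 * k) * (2 * k)`!%:R)%:E)%E.

(** For j = 0 this is the cosine transform of the law of the square root, at t;
    for general j it is the j-th derivative in t of that transform. *)
Definition cos_transform mu (j : nat) (t : R) : R :=
  \int[mu]_x (rt x ^+ j * dcos j (t * rt x)).

Lemma measurable_sqrt : measurable_fun [set: R] rt.
Proof. by apply: continuous_measurable_fun; exact: sqrt_continuous. Qed.

Lemma measurable_sqrt_pow j : measurable_fun [set: R] (fun x => rt x ^+ j).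
Proof. by apply: measurable_funX; exact: measurable_sqrt. Qed.

Lemma continuous_dcos j : continuous (@dcos R j).
Proof.
have -> : @dcos R j = (fun y => dcos j (0 + y)).
  by apply/funext => y; rewrite add0r.
exact: (is_derive_continuous (fun x => is_derive_dcos j 0 x)).
Qed.

Lemma measurable_dcos_sqrt j t : measurable_fun [set: R] (fun x => dcos j (t * rt x)).
Proof.
have mt : measurable_fun [set: R] (fun x => t * rt x).
  by apply: measurable_funM => //; exact: measurable_sqrt.
have md : measurable_fun [set: R] (@dcos R j).
  by apply: continuous_measurable_fun; exact: continuous_dcos.
exact: (measurableT_comp md mt).
Qed.

Lemma sqr_sqrt_le_norm (x : R) k : rt x ^+ (2 * k) <= `|x| ^+ k.
Proof.
rewrite exprM lerXn2r ?nnegrE ?exprn_ge0 ?sqrtr_ge0//.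
have [x0|x0] := leP 0 x; first by rewrite sqr_sqrtr// ger0_norm.
by rewrite (ler0_sqrtr (ltW x0)) expr2 mul0r normr_ge0.
Qed.

Lemma sqrt_pow_le (x : R) j : rt x ^+ j <= 1 + `|x| ^+ j.
Proof.
have [x1|x1] := leP (rt x) 1.
  by rewrite (@le_trans _ _ 1) ?lerDl ?exprn_ge0// exprn_ile1// sqrtr_ge0.
rewrite (@le_trans _ _ (rt x ^+ (2 * j)))//.
  by rewrite ler_weXn2l ?(ltW x1)// leq_pmull.
by rewrite (le_trans (sqr_sqrt_le_norm x j))// lerDr.
Qed.

Section growth.
Variables (C b : R) (mu : probability R R).
Hypothesis mug : moment_growth C b mu.

Lemma growth_abs_moment_lty k : (abs_moment mu k < +oo)%E.
Proof. by rewrite (le_lt_trans (mug k))// ltry. Qed.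

Lemma integrable_abs_pow k : mu.-integrable setT (EFin \o (fun x => `|x| ^+ k)).
Proof.
apply/integrableP; split; first by apply/measurable_EFinP; exact: measurable_abs_pow.
under eq_integral do rewrite /= normrX normr_id.
exact: growth_abs_moment_lty.
Qed.

Lemma integrable_sqrt_pow j : mu.-integrable setT (EFin \o (fun x => rt x ^+ j)).
Proof.
apply: (Rintegrable_le measurableT (g := fun x : R => 1 + `|x| ^+ j)).
- exact: measurable_sqrt_pow.
- by move=> x _; rewrite ger0_norm ?exprn_ge0 ?sqrtr_ge0// sqrt_pow_le.
- apply: Rintegrable_add => //; last exact: integrable_abs_pow.
  exact: (finite_measure_integrable_cst mu 1).
Qed.

Lemma integrable_sqrt_pow_dcos j i t :
  mu.-integrable setT (EFin \o (fun x => rt x ^+ j * dcos i (t * rt x))).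
Proof.
apply: (Rintegrable_le measurableT (g := fun x : R => rt x ^+ j)).
- by apply: measurable_funM; [exact: measurable_sqrt_pow|exact: measurable_dcos_sqrt].
- move=> x _; rewrite normrM ger0_norm ?exprn_ge0 ?sqrtr_ge0//.
  by rewrite ler_piMr ?norm_dcos_le1// exprn_ge0 ?sqrtr_ge0.
- exact: integrable_sqrt_pow.
Qed.

Lemma Rintegral_sqrt_pow_even k :
  \int[mu]_x (rt x ^+ (2 * k)) <= C * b ^+ (2 * k) * (2 * k)`!%:R.
Proof.
rewrite -lee_fin fineK; last first.
  exact: (integrable_fin_num measurableT (integrable_sqrt_pow _)).
apply: le_trans (mug k); apply: ge0_le_integral => //.
- by apply/measurable_EFinP; exact: measurable_sqrt_pow.
- by apply/measurable_EFinP; exact: measurable_abs_pow.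
- by move=> x _; rewrite lee_fin sqr_sqrt_le_norm.
Qed.

Lemma Rintegral_sum (N : nat) (h : nat -> R -> R) :
  (forall i, mu.-integrable setT (EFin \o h i)) ->
  mu.-integrable setT (EFin \o (fun x => \sum_(i < N) h i x)) /\
  \int[mu]_x (\sum_(i < N) h i x) = \sum_(i < N) \int[mu]_x h i x.
Proof.
move=> hi; elim: N => [|N [IHi IH]].
  rewrite big_ord0; split.
    apply: eq_integrable (integrable0 mu _) => // x _.
    by rewrite /= big_ord0.
  by under eq_Rintegral do rewrite big_ord0; rewrite Rintegral_cst// mul0r.
have sumS : (fun x => \sum_(i < N.+1) h i x) = (fun x => \sum_(i < N) h i x + h N x).
  by apply/funext => x; rewrite big_ord_recr.
by rewrite big_ord_recr/= -IH sumS; split; [exact: Rintegrable_add|rewrite RintegralD].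
Qed.

Lemma cos_transform_taylor N j t s : 0 <= s ->
  `|cos_transform mu j (t + s) -
    \sum_(i < N) s ^+ i / i`!%:R * cos_transform mu (i + j) t| <=
  s ^+ N / N`!%:R * \int[mu]_x (rt x ^+ (N + j)).
Proof.
move=> s0.
pose h i x := s ^+ i / i`!%:R * (rt x ^+ (i + j) * dcos (i + j) (t * rt x)).
have hi i : mu.-integrable setT (EFin \o h i).
  by apply: Rintegrable_scale => //; exact: integrable_sqrt_pow_dcos.
have [hsi hs] := Rintegral_sum N hi.
have -> : \sum_(i < N) s ^+ i / i`!%:R * cos_transform mu (i + j) t =
    \int[mu]_x (\sum_(i < N) h i x).
  rewrite hs; apply: eq_bigr => i _; rewrite /h RintegralZl//.
  exact: integrable_sqrt_pow_dcos.
have ci := integrable_sqrt_pow_dcos j j (t + s).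
rewrite /cos_transform -RintegralB//.
rewrite (le_trans (le_normr_Rintegral _ _))//; first exact: Rintegrable_sub.
rewrite -RintegralZl//; last exact: integrable_sqrt_pow.
apply: le_Rintegral => //.
- by apply: integrable_norm; exact: Rintegrable_sub.
- by apply: Rintegrable_scale => //; exact: integrable_sqrt_pow.
move=> x _; have u0 := sqrtr_ge0 x.
have -> : \sum_(i < N) h i x = rt x ^+ j * \sum_(i < N)
    (s * rt x) ^+ i / i`!%:R * dcos (i + j) (t * rt x).
  by rewrite mulr_sumr; apply: eq_bigr => i _; rewrite /h exprD exprMn; ring.
rewrite -mulrBr normrM ger0_norm ?exprn_ge0// mulrDl.
have -> : s ^+ N / N`!%:R * rt x ^+ (N + j) = rt x ^+ j * ((s * rt x) ^+ N / N`!%:R).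
  by rewrite exprD exprMn; ring.
by rewrite ler_wpM2l ?exprn_ge0// dcos_taylor// mulr_ge0.
Qed.

(** The order N = 2 M + j of the expansion is chosen so that N + j is even and the
    moment bound applies. It leaves (N + j)! / N!, which is at most
    2 ^ (N + j) j!, so that the remainder is geometric in 2 b s. The step s is
    bounded in terms of b alone, and not of the point of expansion. *)
Lemma taylor_remainder_bound M j s : 0 <= C -> 0 < b -> 0 <= s -> 4 * b * s <= 1 ->
  s ^+ (2 * M + j) / (2 * M + j)`!%:R * \int[mu]_x (rt x ^+ (2 * M + j + j)) <=
  C * j`!%:R * (2 * b) ^+ j * 2^-1 ^+ M.
Proof.
move=> C0 b0 s0 bs; set N := (2 * M + j)%N.
have -> : (N + j = 2 * (M + j))%N by rewrite /N -addnA addnn -mul2n -mulnDr.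
have sN0 : 0 <= s ^+ N / N`!%:R by rewrite divr_ge0 ?exprn_ge0.
apply: (le_trans (ler_wpM2l sN0 (Rintegral_sqrt_pow_even (M + j)))).
have -> : (2 * (M + j) = N + j)%N by rewrite /N -addnA addnn -mul2n -mulnDr.
have fN : N`!%:R != 0 :> R by rewrite pnatr_eq0 -lt0n fact_gt0.
have -> : (N + j)`!%:R = 'C(N + j, j)%:R * (j`!%:R * N`!%:R) :> R.
  by rewrite -!natrM -(@bin_fact (N + j) j) ?leq_addl// addnK.
have bin2 : 'C(N + j, j)%:R <= 2 ^+ (N + j) :> R.
  rewrite -natrX ler_nat -[X in (_ <= X ^ _)%N]/(1 + 1)%N expnDn.
  rewrite (bigD1 (inord j))//= inordK ?ltnS ?leq_addl//.
  by rewrite !exp1n !muln1 leq_addr.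
have -> : s ^+ N / N`!%:R * (C * b ^+ (N + j) * ('C(N + j, j)%:R * (j`!%:R * N`!%:R))) =
    C * j`!%:R * (s ^+ N * b ^+ (N + j)) * 'C(N + j, j)%:R by field.
apply: (@le_trans _ _ (C * j`!%:R * (s ^+ N * b ^+ (N + j)) * 2 ^+ (N + j))).
  by rewrite ler_wpM2l// !mulr_ge0 ?exprn_ge0// ltW.
have -> : C * j`!%:R * (s ^+ N * b ^+ (N + j)) * 2 ^+ (N + j) =
    C * j`!%:R * (2 * b) ^+ j * (2 * b * s) ^+ N.
  by rewrite !exprD !exprMn; ring.
rewrite ler_wpM2l ?mulr_ge0 ?exprn_ge0 ?mulr_ge0 ?(ltW b0)//.
have bs2 : 2 * b * s <= 2^-1 by lra.
have bs0 : 0 <= 2 * b * s by rewrite !mulr_ge0// ltW.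
apply: (@le_trans _ _ (2^-1 ^+ N)); first by rewrite lerXn2r ?nnegrE.
by rewrite ler_wiXn2l//; [lra|rewrite /N mul2n -addnn -addnA leq_addr].
Qed.

End growth.
End moment_growth.

Section cos_transform_uniqueness.
Context {R : realType}.
Local Notation rt := (@Num.sqrt R).
Variables (mu nu : probability R R) (C b : R).
Hypotheses (C_ge0 : 0 <= C) (b_gt0 : 0 < b).
Hypotheses (mug : moment_growth C b mu) (nug : moment_growth C b nu).

(** The Taylor expansions of order N at t coincide, and both remainders tend
    to 0. *)
Lemma cos_transform_step t s : 0 <= s -> 4 * b * s <= 1 ->
  (forall j, cos_transform mu j t = cos_transform nu j t) ->
  forall j, cos_transform mu j (t + s) = cos_transform nu j (t + s).
Proof.
move=> s0 bs H j; apply/eqP; rewrite -subr_eq0 -normr_eq0.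
set x := `|_|; rewrite eq_le normr_ge0 andbT.
pose D := 2 * (C * j`!%:R * (2 * b) ^+ j).
have xD M : x <= D * 2^-1 ^+ M.
  set N := (2 * M + j)%N.
  have h1 := cos_transform_taylor mug N j t s0.
  have h2 := cos_transform_taylor nug N j t s0.
  have b1 := taylor_remainder_bound mug M j C_ge0 b_gt0 s0 bs.
  have b2 := taylor_remainder_bound nug M j C_ge0 b_gt0 s0 bs.
  have E : \sum_(i < N) s ^+ i / i`!%:R * cos_transform mu (i + j) t =
           \sum_(i < N) s ^+ i / i`!%:R * cos_transform nu (i + j) t.
    by apply: eq_bigr => i _; rewrite H.
  rewrite E in h1.
  have {}h1 := le_trans h1 b1; have {}h2 := le_trans h2 b2.
  rewrite /x (le_trans (ler_distD (\sum_(i < N) s ^+ i / i`!%:R * cos_transform nu (i + j) t) _ _))//.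
  rewrite [X in _ + X]distrC (le_trans (lerD h1 h2))//.
  rewrite le_eqVlt; apply/orP; left; apply/eqP; rewrite /D.
  by ring.
have cD : D * 2^-1 ^+ M @[M --> \oo] --> (0 : R).
  rewrite -[X in _ --> X](mulr0 D); apply: cvgMr; apply: cvg_expr.
  by rewrite ger0_norm ?invr_ge0// invf_lt1// ltr1n.
have cx : (fun _ : nat => x) @ \oo --> x by exact: cvg_cst.
by apply: (ler_cvg_to cx cD); apply: nearW.
Qed.

Hypotheses (smu : supported_on_nonneg mu) (snu : supported_on_nonneg nu).
Hypothesis moment_eq : forall k, moment nu k = moment mu k.

Lemma Rintegral_sqrt_pow_moment (m : probability R R) k :
  supported_on_nonneg m -> \int[m]_x (rt x ^+ (2 * k)) = fine (moment m k).
Proof.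
move=> sm; congr fine; apply: ae_eq_integral => //.
- by apply/measurable_EFinP; exact: measurable_sqrt_pow.
- by apply/measurable_EFinP; exact: exprn_measurable.
- by apply: filterS (supported_ae sm) => x x0 _; rewrite exprM sqr_sqrtr.
Qed.

(** The derivatives at 0 are moments of the measure in even order, up to sign,
    and they vanish in odd order. *)
Lemma cos_transform_0 j : cos_transform mu j 0 = cos_transform nu j 0.
Proof.
have E m C' b' : moment_growth C' b' m ->
    cos_transform m j 0 = (\int[m]_x (rt x ^+ j)) * dcos j 0.
  move=> mg; rewrite -RintegralZr//; last exact: (integrable_sqrt_pow mg).
  by apply: eq_Rintegral => x _; rewrite mul0r.
rewrite (E _ _ _ mug) (E _ _ _ nug).
have [oj|ej] := boolP (odd j); first by rewrite dcos_odd0// !mulr0.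
have -> : j = (2 * j./2)%N by rewrite mul2n even_halfK.
by rewrite !Rintegral_sqrt_pow_moment// moment_eq.
Qed.

(** Steps of the same admissible length reach any t from 0. *)
Lemma cos_transform_eq j t : 0 <= t -> cos_transform mu j t = cos_transform nu j t.
Proof.
move=> t0; have tb0 : 0 <= 4 * b * t by rewrite !mulr_ge0// ltW.
set n := (Num.truncn (4 * b * t)).+1.
pose s := t / n%:R.
have n0 : 0 < n%:R :> R by rewrite ltr0n.
have s0 : 0 <= s by rewrite divr_ge0// ltW.
have bs : 4 * b * s <= 1.
  by rewrite /s mulrA ler_pdivrMr// mul1r ltW// truncnS_gt.
have H i : forall j, cos_transform mu j (i%:R * s) = cos_transform nu j (i%:R * s).
  elim: i => [|i IH] k; first by rewrite mul0r cos_transform_0.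
  by rewrite -natr1 mulrDl mul1r; exact: cos_transform_step.
by have := H n j; rewrite /s mulrC divfK// gt_eqF.
Qed.

End cos_transform_uniqueness.

(** * From cosine transforms to resolvents *)

Section stieltjes_transform.
Context {R : realType}.
Local Notation TR := (measurableTypeR R).
Local Notation leb := (@lebesgue_measure R).
Local Notation rt := (@Num.sqrt R).

Section laplace_of_cosine.
Variables (a u : R).
Hypothesis a_gt0 : 0 < a.

Let q := a ^+ 2 + u ^+ 2.
Let q_gt0 : 0 < q. Proof. by rewrite ltr_pwDl ?exprn_gt0// sqr_ge0. Qed.

(* The primitive of f that tends to 0 at infinity. *)
Let F (t : R) : R := expR (- (a * t)) * (u * sin (t * u) - a * cos (t * u)) / q.
Let f (t : R) : R := expR (- (a * t)) * cos (t * u).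

Let dtu t : is_derive t (1 : R) (fun t => t * u) u.
Proof.
have := is_derive_linear u t.
by rewrite (_ : (fun y => u * y) = (fun y => y * u))//; apply/funext => y; exact: mulrC.
Qed.

Let dF t : is_derive t (1 : R) F (f t).
Proof.
have dtrig := is_derive_subf
  (is_derive_mulf (is_derive_cst u t 1) (is_derive_sinf (dtu t)))
  (is_derive_mulf (is_derive_cst a t 1) (is_derive_cosf (dtu t))).
have := is_derive_mulf (is_derive_mulf (is_derive_expN a t) dtrig)
  (is_derive_cst (q^-1 : R) t 1).
move=> h; apply: (is_derive_eq h); rewrite /f /=.
have q0 : q != 0 by rewrite gt_eqF.
rewrite mulr0 addr0 !mul0r !add0r; apply: (mulIf q0); rewrite divfK//.
by rewrite /q; ring.
Qed.

Lemma continuous_damped_cosine : continuous f.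
Proof.
have dcosu t := is_derive_mulf (is_derive_expN a t) (is_derive_cosf (dtu t)).
exact: (is_derive_continuous dcosu).
Qed.

Lemma integrable_damped_cosine : leb.-integrable `[0%R, +oo[ (EFin \o f).
Proof.
apply: (Rintegrable_le _ (g := fun t : TR => expR (- (a * t)))) => //.
- apply: measurable_funTS; apply: continuous_measurable_fun.
  exact: continuous_damped_cosine.
- by move=> t _; rewrite normrM ger0_norm ?expR_ge0// ler_piMr ?expR_ge0 ?cos_max.
- exact: integrable_expN.
Qed.

Lemma integral_damped_cosine :
  \int[leb]_(t in `[0%R, +oo[) (expR (- (a * t)) * cos (t * u)) = a / (a ^+ 2 + u ^+ 2).
Proof.
rewrite (FTC_halfline (l := 0) continuous_damped_cosine dF integrable_damped_cosine).
  rewrite /F mulr0 oppr0 expR0 mul0r sin0 cos0 mulr0 mulr1 !sub0r mul1r.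
  by rewrite mulNr opprK.
have bound n : `|F n%:R| <= (`|u| + a) / q * expR (- (a * n%:R)).
  rewrite /F !normrM (ger0_norm (expR_ge0 _)) normfV (gtr0_norm q_gt0).
  rewrite -mulrA mulrC ler_wpM2r ?expR_ge0// ler_wpM2r ?invr_ge0 ?(ltW q_gt0)//.
  rewrite (le_trans (ler_normB _ _))// !normrM (gtr0_norm a_gt0) lerD//.
    by rewrite ler_piMr// sin_max.
  by rewrite ler_piMr ?cos_max// ltW.
apply: norm_cvg0.
apply: (@squeeze_cvgr _ _ _ _ (fun=> 0) (fun n => (`|u| + a) / q * expR (- (a * n%:R)))).
- by apply: nearW => n; rewrite normr_ge0 bound.
- exact: cvg_cst.
- by rewrite -[X in _ --> X](mulr0 ((`|u| + a) / q)); apply: cvgMr; exact: cvgn_expN.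
Qed.

End laplace_of_cosine.

(** Fubini's theorem exchanges the integral over mu with the Laplace transform
    in t, whose value on t |-> cos(t u) is a / (a ^ 2 + u ^ 2). *)
Lemma laplace_cos_transform (mu : probability R R) (a : R) : 0 < a ->
  \int[mu]_x (a / (a ^+ 2 + rt x ^+ 2)) =
  \int[leb]_(t in `[0%R, +oo[) (expR (- (a * t)) * cos_transform mu 0 t).
Proof.
move=> a0; pose D : set TR := `[0%R, +oo[%classic.
have mD : measurable D by exact: measurable_itv.
pose f (z : R * TR) : R := expR (- (a * z.2)) * cos (z.2 * rt z.1) * \1_D z.2.
have mf : measurable_fun setT f.
  have m2 : measurable_fun setT (fun z : R * TR => z.2 : R) := measurable_snd.
  have m1 : measurable_fun setT (fun z : R * TR => z.1 : R) := measurable_fst.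
  apply: measurable_funM; last first.
    exact: (measurableT_comp (@measurable_indic _ TR R setT D mD) measurable_snd).
  apply: measurable_funM; first exact: (measurableT_comp (measurable_expN a) m2).
  have mz : measurable_fun setT (fun z : R * TR => z.2 * rt z.1 : R).
    by apply: measurable_funM => //; exact: (measurableT_comp measurable_sqrt m1).
  have mc : measurable_fun [set: R] (@cos R).
    by apply: continuous_measurable_fun; exact: continuous_cos.
  exact: (measurableT_comp mc mz).
have mEf : measurable_fun setT (EFin \o f) by exact/measurable_EFinP.
have inner x : (\int[leb]_t (f (x, t))%:E = (a / (a ^+ 2 + rt x ^+ 2))%:E)%E.
  rewrite -(integral_damped_cosine (rt x) a0) /Rintegral fineK; last first.
    by apply: integrable_fin_num => //; exact: integrable_damped_cosine.
  rewrite [RHS]integral_mkcond; apply: eq_integral => t _.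
  rewrite patchE /f/= indicE; case: (t \in D); by rewrite ?mulr1 ?mulr0.
have inner_abs x : (\int[leb]_t `|(f (x, t))%:E| <= (a^-1)%:E)%E.
  rewrite -(integral_expN a0) [leRHS]integral_mkcond.
  apply: ge0_le_integral => //.
  - apply: measurableT_comp => //.
    exact: (measurableT_comp mEf (measurable_pair1 x)).
  - apply: (measurable_restrictT _ mD).1; apply/measurable_EFinP.
    by apply: measurable_funTS; exact: measurable_expN.
  - move=> t _; rewrite patchE /f/= indicE; case: (t \in D); last first.
      by rewrite mulr0 normr0.
    rewrite mulr1 lee_fin normrM ger0_norm ?expR_ge0//.
    by rewrite ler_piMr ?expR_ge0// cos_max.
have fi : (mu \x leb)%E.-integrable setT (EFin \o f).
  apply/(integrable12ltyP _ _ mEf).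
  apply: (@le_lt_trans _ _ (\int[mu]_x (a^-1)%:E)%E).
    apply: ge0_le_integral => //.
    - by move=> x _; apply: integral_ge0.
    - have mabs : measurable_fun setT (abse \o (EFin \o f)) by apply: measurableT_comp.
      exact: (measurable_fun_fubini_tonelli_F _ mabs (fun z => abse_ge0 _)).
    - by move=> x _; exact: inner_abs.
  rewrite (_ : integral _ _ _ = (a^-1)%:E * mu setT)%E; last exact: integral_cst.
  by rewrite -[X in (_ * X)%E]/(mu setT) probability_setT mule1 ltry.
have := Fubini fi.
under eq_integral do rewrite inner.
rewrite /Rintegral => ->.
congr fine; rewrite [RHS]integral_mkcond; apply: eq_integral => t _.
rewrite patchE /f/= indicE; case: (t \in D) => /=; last first.
  by under eq_integral do rewrite mulr0; rewrite integral0.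
under eq_integral do rewrite mulr1.
have ci : mu.-integrable setT (EFin \o (fun x => cos (t * rt x))).
  apply: (Rintegrable_le measurableT (g := fun _ : R => 1)).
  - have := measurable_dcos_sqrt 0 t; rewrite (_ : dcos 0 = cos)//.
    by apply/funext => y; rewrite dcos0.
  - by move=> x _; exact: cos_max.
  - exact: (finite_measure_integrable_cst mu 1).
have -> : cos_transform mu 0 t = \int[mu]_x cos (t * rt x).
  by apply: eq_Rintegral => x _; rewrite expr0 mul1r dcos0.
rewrite EFinM /Rintegral fineK; last exact: integrable_fin_num ci.
by rewrite -integralZl.
Qed.

End stieltjes_transform.

Section resolvent_powers.
Context {R : realType}.
Local Notation rt := (@Num.sqrt R).

(** On the half-line this is 1 / (z + x). The squared square root is the positive
    part of x, so the function is also bounded by 1 / z on the whole line. *)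
Definition resolvent (z x : R) : R := (z + rt x ^+ 2)^-1.

Lemma resolvent_den_gt0 (z x : R) : 0 < z -> 0 < z + rt x ^+ 2.
Proof. by move=> z0; rewrite ltr_pwDl// sqr_ge0. Qed.

Lemma resolvent_gt0 (z x : R) : 0 < z -> 0 < resolvent z x.
Proof. by move=> z0; rewrite invr_gt0 resolvent_den_gt0. Qed.

Lemma resolvent_le (z x : R) : 0 < z -> resolvent z x <= z^-1.
Proof.
by move=> z0; rewrite lef_pV2 ?posrE ?resolvent_den_gt0// lerDl sqr_ge0.
Qed.

Lemma measurable_resolvent z : 0 < z -> measurable_fun [set: R] (resolvent z).
Proof.
move=> z0; apply: continuous_measurable_fun => x.
apply: cvgV; first by rewrite gt_eqF// resolvent_den_gt0.
apply: cvgD; first exact: cvg_cst.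
apply: (@continuous_comp _ _ _ rt (fun y => y ^+ 2)); first exact: sqrt_continuous.
exact: exprn_continuous.
Qed.

Lemma measurable_resolvent_pow z k : 0 < z ->
  measurable_fun [set: R] (fun x => resolvent z x ^+ k).
Proof. by move=> z0; apply: measurable_funX; exact: measurable_resolvent. Qed.

Lemma integrable_resolvent_pow (m : probability R R) z k : 0 < z ->
  m.-integrable setT (EFin \o (fun x => resolvent z x ^+ k)).
Proof.
move=> z0; apply: (Rintegrable_le measurableT (g := fun _ : R => z^-1 ^+ k)).
- exact: measurable_resolvent_pow.
- move=> x _; have r0 := ltW (resolvent_gt0 x z0).
  have z10 : 0 <= z^-1 by rewrite invr_ge0 ltW.
  rewrite ger0_norm ?exprn_ge0//; apply: lerXn2r; rewrite ?nnegrE//.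
  exact: resolvent_le.
- exact: (finite_measure_integrable_cst m (z^-1 ^+ k)).
Qed.

Lemma cvgn_sum (N : nat) (h : nat -> nat -> R) (l : nat -> R) :
  (forall i, h i n @[n --> \oo] --> l i) ->
  \sum_(i < N) h i n @[n --> \oo] --> \sum_(i < N) l i.
Proof.
move=> hl; elim: N => [|N IH].
  by rewrite big_ord0; under eq_cvg do rewrite big_ord0; exact: cvg_cst.
rewrite big_ord_recr/=; under eq_cvg do rewrite big_ord_recr/=.
by apply: cvgD; [exact: IH|exact: hl].
Qed.

Variables (mu nu : probability R R).
Hypothesis resolvent_eq : forall z, 0 < z ->
  \int[mu]_x resolvent z x = \int[nu]_x resolvent z x.

(** The derivative of the k-th power of the resolvent with respect to z is - k
    times the next power. The difference quotients Q of step 1 / (n + 1) have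
    the same integrals under both measures, are uniformly bounded, and converge
    to L, the opposite of the derivative. *)
Lemma resolvent_pow_eq k z : 0 < z ->
  \int[mu]_x resolvent z x ^+ k.+1 = \int[nu]_x resolvent z x ^+ k.+1.
Proof.
elim: k z => [|k IH] z z0.
  by have := resolvent_eq z0; under eq_Rintegral do rewrite -[resolvent z _]expr1;
    move=> ->; apply: eq_Rintegral => x _; rewrite expr1.
pose h (n : nat) : R := n.+1%:R^-1.
have h0 n : 0 < h n by rewrite invr_gt0 ltr0n.
have zh n : 0 < z + h n by rewrite addr_gt0.
pose Q n x := (h n)^-1 * (resolvent z x ^+ k.+1 - resolvent (z + h n) x ^+ k.+1).
pose L x := k.+1%:R * resolvent z x ^+ k.+2.
have QE n x : Q n x = resolvent z x * resolvent (z + h n) x *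
    \sum_(i < k.+1) resolvent z x ^+ (k - i) * resolvent (z + h n) x ^+ i.
  rewrite /Q subrXX mulrA; congr (_ * _).
  rewrite /resolvent; field.
  by rewrite !gt_eqF ?resolvent_den_gt0.
have mQ n : measurable_fun [set: R] (Q n).
  apply: measurable_funM => //; apply: measurable_funB; exact: measurable_resolvent_pow.
have mL : measurable_fun [set: R] L.
  by apply: measurable_funM => //; exact: measurable_resolvent_pow.
have QL x : Q n x @[n --> \oo] --> L x.
  under eq_cvg do rewrite QE.
  have cr : resolvent (z + h n) x @[n --> \oo] --> resolvent z x.
    apply: cvgV; first by rewrite gt_eqF// resolvent_den_gt0.
    apply: cvgD; last exact: cvg_cst.
    rewrite -[X in _ --> X]addr0; apply: cvgD; first exact: cvg_cst.
    exact: cvg_harmonic.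
  have -> : L x = resolvent z x * resolvent z x *
      \sum_(i < k.+1) resolvent z x ^+ (k - i) * resolvent z x ^+ i.
    rewrite (eq_bigr (fun _ : 'I_k.+1 => resolvent z x ^+ k)); last first.
      by move=> i _; rewrite -exprD subnK// -ltnS.
    by rewrite sumr_const card_ord /L !exprS -mulr_natl; ring.
  apply: cvgM; first exact: cvgMr.
  apply: (@cvgn_sum _
    (fun i n => resolvent z x ^+ (k - i) * resolvent (z + h n) x ^+ i)
    (fun i => resolvent z x ^+ (k - i) * resolvent z x ^+ i)) => i; apply: cvgMr.
  apply: (@cvg_comp _ _ _ (fun n => resolvent (z + h n) x) (fun y : R => y ^+ i)
    _ _ _ cr).
  exact: exprn_continuous.
pose M : R := (z^-1) ^+ 2 * (k.+1%:R * z^-1 ^+ k).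
have QM n x : `|Q n x| <= M.
  have p0 := ltW (resolvent_gt0 x z0); have q0 := ltW (resolvent_gt0 x (zh n)).
  have pz := resolvent_le x z0.
  have qz : resolvent (z + h n) x <= z^-1.
    by rewrite (le_trans (resolvent_le x (zh n)))// lef_pV2 ?posrE// lerDl ltW.
  have z10 : 0 <= z^-1 by rewrite invr_ge0 ltW.
  rewrite QE ger0_norm; last first.
    by rewrite !mulr_ge0// sumr_ge0// => i _; rewrite mulr_ge0 ?exprn_ge0.
  rewrite /M; apply: ler_pM; rewrite ?mulr_ge0//.
  - by rewrite sumr_ge0// => i _; rewrite mulr_ge0 ?exprn_ge0.
  - by rewrite expr2 ler_pM.
  - rewrite (@le_trans _ _ (\sum_(i < k.+1) z^-1 ^+ k))//; last first.
      by rewrite sumr_const card_ord mulr_natl.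
    apply: ler_sum => i _.
    rewrite -[X in _ <= z^-1 ^+ X](@subnK i k) -1?ltnS// exprD.
    by rewrite ler_pM ?exprn_ge0// lerXn2r ?nnegrE.
have cvgQ (m : probability R R) : \int[m]_x Q n x @[n --> \oo] --> \int[m]_x L x.
  apply: (Rintegral_dominated (g := fun _ : R => M)) => //.
  exact: (finite_measure_integrable_cst m M).
have Qeq n : \int[mu]_x Q n x = \int[nu]_x Q n x.
  have QI (m : probability R R) : \int[m]_x Q n x = (h n)^-1 *
      (\int[m]_x resolvent z x ^+ k.+1 - \int[m]_x resolvent (z + h n) x ^+ k.+1).
    rewrite -RintegralB//; [|exact: integrable_resolvent_pow..].
    rewrite -RintegralZl//; apply: Rintegrable_sub => //; exact: integrable_resolvent_pow.
  by rewrite !QI !IH.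
have LI (m : probability R R) : \int[m]_x L x = k.+1%:R * \int[m]_x resolvent z x ^+ k.+2.
  by rewrite RintegralZl//; exact: integrable_resolvent_pow.
have : \int[mu]_x L x = \int[nu]_x L x.
  have c1 := cvgQ mu; rewrite (funext Qeq) in c1.
  exact: (cvg_unique _ c1 (cvgQ nu)).
by rewrite !LI => /mulfI; apply; rewrite pnatr_eq0.
Qed.

End resolvent_powers.

(** * From resolvents to the law *)

Section threshold.
Context {R : realType}.
Implicit Types y K : R.

Lemma bernoulli_ge (s : R) N : 0 <= s <= 1 -> 1 - N%:R * s <= (1 - s) ^+ N.
Proof.
move=> /andP[s0 s1]; elim: N => [|N IH]; first by rewrite mul0r subr0 expr0.
have s1' : 0 <= 1 - s by lra.
rewrite exprS; apply: (@le_trans _ _ ((1 - s) * (1 - N%:R * s))); last first.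
  by rewrite ler_wpM2l.
rewrite -natr1; have : 0 <= N%:R * (s * s) by rewrite !mulr_ge0.
by move=> ?; lra.
Qed.

Lemma cvgn_mul_geometric (q : R) : 0 <= q < 1 -> n%:R * q ^+ n @[n --> \oo] --> (0 : R).
Proof.
move=> /andP[]; rewrite le_eqVlt => /predU1P[<- _|q0 q1].
  apply: cvg_near_cst; near=> n; rewrite expr0n gtn_eqF ?mulr0//.
  by near: n; exact: nbhs_infty_gt.
pose a := - ln q.
have a0 : 0 < a by rewrite oppr_gt0 ln_lt0// q0.
have := @cvgn_monomial_expN R 1 a a0.
congr (cvg_to (_ @ \oo) _); apply/funext => n /=.
by rewrite expr1 -mulNr opprK expRM_natr lnK.
Unshelve. all: by end_near. Qed.

(** With N equal to about n K ^ n, the power (1 - y ^ n) ^ N is close to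
    exp(- n (K y) ^ n), which tends to 1 when K y < 1 and to 0 when K y >= 1. The
    factor n settles the boundary case K y = 1. *)
Definition threshold_exponent K n : nat := (Num.truncn (n%:R * K ^+ n)).+1.

Definition threshold_approx K n y : R := (1 - y ^+ n.+1) ^+ threshold_exponent K n.+1.

Lemma threshold_approx_itv K n y : 0 <= y <= 1 -> 0 <= threshold_approx K n y <= 1.
Proof.
move=> /andP[y0 y1]; have s0 : 0 <= y ^+ n.+1 by rewrite exprn_ge0.
have s1 : y ^+ n.+1 <= 1 by rewrite exprn_ile1.
by rewrite exprn_ge0 ?exprn_ile1//; lra.
Qed.

(** By Bernoulli's inequality the distance to 1 is at most N y ^ n, which is of
    the order of n (K y) ^ n. *)
Lemma cvgn_threshold_lt K y : 1 <= K -> 0 <= y -> K * y < 1 ->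
  threshold_approx K n y @[n --> \oo] --> (1 : R).
Proof.
move=> K1 y0 Ky.
have y1 : y < 1 by rewrite (le_lt_trans _ Ky)// ler_peMl.
have Ky0 : 0 <= K * y by rewrite mulr_ge0// (le_trans _ K1).
have cl : 1 - (n.+1%:R * (K * y) ^+ n.+1 + y ^+ n.+1) @[n --> \oo] --> (1 : R).
  rewrite -[X in _ --> X]subr0; apply: cvgB; first exact: cvg_cst.
  rewrite -[X in _ --> X]addr0; apply: cvgD.
    rewrite (cvg_shiftS (fun n => n%:R * (K * y) ^+ n)).
    by apply: cvgn_mul_geometric; rewrite Ky0.
  rewrite (cvg_shiftS (fun n => y ^+ n)).
  by apply: cvg_expr; rewrite ger0_norm.
apply: (@squeeze_cvgr _ _ _ _
  (fun n => 1 - (n.+1%:R * (K * y) ^+ n.+1 + y ^+ n.+1)) (fun=> 1)) => //; last first.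
  exact: cvg_cst.
apply: nearW => n.
have s0 : 0 <= y ^+ n.+1 by rewrite exprn_ge0.
have s1 : y ^+ n.+1 <= 1 by rewrite exprn_ile1// ltW.
have yi : 0 <= y <= 1 by rewrite y0 ltW.
have /andP[_ ->] := threshold_approx_itv K n yi.
rewrite andbT (le_trans _ (@bernoulli_ge _ _ _)) ?s0 ?s1//.
rewrite lerD2l lerN2 exprMn mulrA -[X in _ + X]mul1r -mulrDl ler_wpM2r//.
rewrite /threshold_exponent -[X in X <= _]natr1 lerD2r truncn_le.
by rewrite mulr_ge0// exprn_ge0// (le_trans _ K1).
Qed.

(** By the inequality 1 - s <= exp(- s) the approximation is at most
    exp(- N y ^ n), where N y ^ n >= n. *)
Lemma cvgn_threshold_ge K y : 0 <= K -> 0 <= y <= 1 -> 1 <= K * y ->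
  threshold_approx K n y @[n --> \oo] --> (0 : R).
Proof.
move=> K0 /andP[y0 y1] Ky.
have c0 : expR (- n.+1%:R) @[n --> \oo] --> (0 : R).
  rewrite (cvg_shiftS (fun n => expR (- n%:R))).
  exact: cvgn_expR.
apply: (@squeeze_cvgr _ _ _ _ (fun=> 0) (fun n => expR (- n.+1%:R))) => //; last first.
  exact: cvg_cst.
apply: nearW => n.
have s0 : 0 <= y ^+ n.+1 by rewrite exprn_ge0.
have s1 : y ^+ n.+1 <= 1 by rewrite exprn_ile1.
have yi : 0 <= y <= 1 by rewrite y0.
have /andP[-> _] := threshold_approx_itv K n yi.
rewrite andTb /threshold_approx.
apply: (@le_trans _ _ (expR (- y ^+ n.+1) ^+ threshold_exponent K n.+1)).
  rewrite lerXn2r ?nnegrE ?expR_ge0 ?subr_ge0//.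
  by have := expR_ge1Dx (- y ^+ n.+1).
rewrite -expRM_natr ler_expR mulNr lerN2.
apply: (@le_trans _ _ (y ^+ n.+1 * (n.+1%:R * K ^+ n.+1))).
  rewrite mulrCA -exprMn ler_peMr// mulrC.
  by rewrite exprn_ege1// mulrC.
by rewrite ler_wpM2l// ltW// truncnS_gt.
Qed.

End threshold.

Section rays.
Context {R : realType}.
Local Notation rt := (@Num.sqrt R).
Variables (mu nu : probability R R).
Hypothesis resolvent_eq : forall z, 0 < z ->
  \int[mu]_x resolvent z x = \int[nu]_x resolvent z x.

Let y (x : R) : R := resolvent 1 x.

Let y_itv x : 0 <= y x <= 1.
Proof.
by rewrite ltW ?resolvent_gt0//= (le_trans (resolvent_le _ _))// invr1.
Qed.

Lemma integral_y_pow k : \int[mu]_x (y x ^+ k) = \int[nu]_x (y x ^+ k).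
Proof.
case: k => [|k]; last exact: resolvent_pow_eq.
have E (m : probability R R) : \int[m]_x (y x ^+ 0) = 1.
  under eq_Rintegral do rewrite expr0.
  by rewrite Rintegral_cst// mul1r [X in fine X](probability_setT m).
by rewrite !E.
Qed.

Lemma integral_threshold K n :
  \int[mu]_x threshold_approx K n (y x) = \int[nu]_x threshold_approx K n (y x).
Proof.
rewrite /threshold_approx; set N := threshold_exponent K n.+1.
pose h i x := (-1) ^+ i * 'C(N, i)%:R * y x ^+ (n.+1 * i).
have E x : (1 - y x ^+ n.+1) ^+ N = \sum_(i < N.+1) h i x.
  rewrite exprBn; apply: eq_bigr => i _.
  by rewrite /h expr1n mulr1 -exprM -mulr_natr; ring.
have hi (m : probability R R) i : m.-integrable setT (EFin \o h i).
  by apply: Rintegrable_scale => //; exact: integrable_resolvent_pow.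
have I (m : probability R R) : \int[m]_x ((1 - y x ^+ n.+1) ^+ N) =
    \sum_(i < N.+1) (-1) ^+ i * 'C(N, i)%:R * \int[m]_x (y x ^+ (n.+1 * i)).
  under eq_Rintegral do rewrite E.
  have [_ ->] := Rintegral_sum N.+1 (hi m).
  apply: eq_bigr => i _; rewrite RintegralZl//.
  exact: integrable_resolvent_pow.
by rewrite !I; apply: eq_bigr => i _; rewrite integral_y_pow.
Qed.

(** With y = 1 / (1 + x) and K = 1 + a, the condition K y < 1 says a < x. Hence
    the threshold approximations, which are polynomials in y, converge boundedly
    to the indicator of the ray. *)
Lemma ray_eq_nonneg (a : R) : 0 <= a -> mu `]a, +oo[%classic = nu `]a, +oo[%classic.
Proof.
move=> a0; pose K := 1 + a.
have K1 : 1 <= K by rewrite lerDl.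
pose S : set R := `]a, +oo[%classic.
have mS : measurable S by exact: measurable_itv.
have lim x : threshold_approx K n (y x) @[n --> \oo] --> (\1_S x : R).
  have /andP[y0 y1] := y_itv x.
  have den := resolvent_den_gt0 x (@ltr01 R).
  rewrite indicE; case: (boolP (x \in S)) => [/set_mem|/negP xS].
    rewrite /S/= in_itv/= andbT => ax.
    apply: cvgn_threshold_lt => //.
    rewrite /y /resolvent ltr_pdivrMr// mul1r /K ltrD2l sqr_sqrtr//.
    by rewrite ltW// (le_lt_trans a0).
  apply: cvgn_threshold_ge => //; first by rewrite (le_trans _ K1).
  rewrite /y /resolvent ler_pdivlMr// mul1r /K lerD2l.
  have xa : x <= a.
    by rewrite leNgt; apply/negP => ax; apply: xS; apply/mem_set; rewrite /S/= in_itv/= ax.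
  have [x0|x0] := leP 0 x; first by rewrite sqr_sqrtr.
  by rewrite (ler0_sqrtr (ltW x0)) expr2 mul0r.
have cvgI (m : probability R R) :
    \int[m]_x threshold_approx K n (y x) @[n --> \oo] --> \int[m]_x (\1_S x : R).
  apply: (Rintegral_dominated (g := fun _ : R => 1)) => //.
  - move=> n; apply: measurable_funX; apply: measurable_funB => //.
    exact: measurable_resolvent_pow.
  - exact: (finite_measure_integrable_cst m 1).
  - move=> n x _; have /andP[t0 t1] := threshold_approx_itv K n (y_itv x).
    by rewrite ger0_norm.
have E (m : probability R R) : m S = (\int[m]_x (\1_S x : R))%:E.
  rewrite /Rintegral integral_indic// setIT fineK//.
  exact: fin_num_measure.
rewrite -/S !E; congr EFin.
have c1 := cvgI mu; rewrite (funext (integral_threshold K)) in c1.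
exact: (cvg_unique _ c1 (cvgI nu)).
Qed.

Hypotheses (smu : supported_on_nonneg mu) (snu : supported_on_nonneg nu).

Lemma resolvent_measure_eq (A : set R) : measurable A -> mu A = nu A.
Proof.
apply: right_ray_probability_unique => x.
have [x0|x0] := leP 0 x; first exact: ray_eq_nonneg.
have full (m : probability R R) : supported_on_nonneg m -> m `]x, +oo[%classic = 1%E.
  move=> sm; apply/eqP; rewrite eq_le probability_le1//= -sm.
  apply: le_measure; rewrite ?inE//.
  by move=> z; rewrite /= !in_itv/= !andbT; exact: lt_le_trans.
by rewrite !full.
Qed.

End rays.

(** A competitor nu has the same moments as mu, hence satisfies the same growth
    condition. The cosine transforms agree, and their Laplace transforms at
    the square root of z give the integrals of the resolvent at z. *)
Theorem moment_growth_unique {R : realType} (C b : R) (mu : probability R R) :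
  0 <= C -> 0 < b -> supported_on_nonneg mu -> moment_growth C b mu ->
  stieltjes_unique mu.
Proof.
move=> C0 b0 smu mug nu snu meq A mA.
have nug : moment_growth C b nu.
  by move=> k; rewrite /abs_moment -moment_normr// meq moment_normr//; exact: mug.
apply: resolvent_measure_eq => // z z0.
have a0 : 0 < Num.sqrt z by rewrite sqrtr_gt0.
have RE (m : probability R R) : \int[m]_x (Num.sqrt z / (Num.sqrt z ^+ 2 + Num.sqrt x ^+ 2)) =
    Num.sqrt z * \int[m]_x resolvent z x.
  rewrite -RintegralZl//.
    by apply: eq_Rintegral => x _; rewrite sqr_sqrtr// ltW.
  have := integrable_resolvent_pow m 1 z0.
  by under [X in _.-integrable _ (_ \o X)]eq_fun do rewrite expr1.
have : \int[nu]_x (Num.sqrt z / (Num.sqrt z ^+ 2 + Num.sqrt x ^+ 2)) =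
    \int[mu]_x (Num.sqrt z / (Num.sqrt z ^+ 2 + Num.sqrt x ^+ 2)).
  rewrite !laplace_cos_transform//; apply: eq_Rintegral => t; rewrite inE/= in_itv/= andbT => t0.
  congr (_ * _); apply/esym.
  exact: (cos_transform_eq C0 b0 mug nug smu snu meq).
by rewrite !RE => /mulfI; apply; rewrite gt_eqF.
Qed.

(** * Moment determinacy of powers and products *)

Section laws_of_products.
Context d (T : measurableType d) (R : realType) (P : probability T R).
Variables (n : nat) (xis : 'I_n -> {RV P >-> R}).
Hypothesis hindep : mutually_independent xis.
Hypothesis hdens : forall i, has_half_logistic_density (distribution P (xis i)).

Local Notation law m := (distribution P (prefix_RV xis m)).

Lemma prefix_law_supported m : (m <= n)%N -> supported_on_nonneg (law m).
Proof.
elim: m => [_|m IH mn].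
  transitivity (P setT); last exact: probability_setT.
  congr (P _).
  by apply/seteqP; split=> t //= _; rewrite prefix_prod0 in_itv/= ler01.
apply: (supported_mult_conv (prefix_law_mult_conv hindep mn)); first exact/IH/ltnW.
exact: half_logistic_supported.
Qed.

Lemma prefix_law_abs_moment_le m k : (m <= n)%N ->
  (abs_moment (law m) k <= ((4 * 2 ^+ k * k`!%:R) ^+ m)%:E)%E.
Proof.
elim: m => [_|m IH mn].
  rewrite /abs_moment ge0_integral_distribution//; last first.
    by apply/measurable_EFinP; exact: measurable_abs_pow.
  rewrite expr0 (eq_integral (cst 1%E)); last first.
    by move=> t _ /=; rewrite prefix_prod0 normr1 expr1n.
  by rewrite integral_cst// mul1e [X in (X <= _)%E]probability_setT.
rewrite /abs_moment (abs_moment_mult_conv _ (prefix_law_mult_conv hindep mn)).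
rewrite exprSr EFinM; apply: lee_pmul.
- exact: abs_moment_ge0.
- exact: abs_moment_ge0.
- exact: IH (ltnW mn).
- exact: half_logistic_abs_moment_le.
Qed.

(** The induction starts at one factor: the empty product has a point mass as its
    law, which dominates no density. *)
Lemma prefix_law_minorant m : (m < n)%N ->
  exists c a : R, [/\ 0 < c, 0 < a & stretched_minorant m.+1 c a (law m.+1)].
Proof.
elim: m => [mn|m IH mn].
  exists (2^-1 / 0`!%:R), 2; split=> //.
  apply: (power_law_minorant (hdens (Ordinal mn))) => A mA.
  congr (P _); apply/seteqP.
  by split=> t /=; rewrite (prefix_prodS _ mn) prefix_prod0 mul1r expr1.
have [c [a [c0 a0 lb]]] := IH (ltnW mn).
exists (c * m.+2%:R / 4), (2 * a + 1); split.
- by rewrite !mulr_gt0// invr_gt0.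
- by rewrite addr_gt0// mulr_gt0.
- exact: (stretched_minorant_mult_conv c0 a0 lb (hdens _) (prefix_law_mult_conv hindep mn)).
Qed.

End laws_of_products.

Lemma fact_sqr_le k : (k`! * k`! <= (2 * k)`!)%N.
Proof.
have := @bin_fact (2 * k) k; rewrite mul2n -addnn leq_addr => /(_ isT) <-.
rewrite addnK; apply: leq_pmull.
by rewrite bin_gt0 leq_addr.
Qed.

(** For the square and for the product of two copies the k-th moment is at most a
    geometric factor times (2 k)!, which is the growth that the
    determinacy criterion allows; a single variable is far below it. *)
Section growth_bounds.
Context {R : realType}.

Lemma pow2_fact_le k : 4 * 2 ^+ k * k`!%:R <= 16 * 2 ^+ (2 * k) * (2 * k)`!%:R :> R.
Proof.
apply: ler_pM; rewrite ?mulr_ge0 ?exprn_ge0//.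
  apply: ler_pM; rewrite ?exprn_ge0//; first by rewrite ler_nat.
  by rewrite ler_weXn2l// ?ler1n// leq_pmull.
by rewrite ler_nat (leq_trans _ (fact_sqr_le k))// leq_pmulr// fact_gt0.
Qed.

Lemma power_growth n (la nu : probability R R) : (0 < n <= 2)%N ->
  has_half_logistic_density la -> is_power_law n la nu -> moment_growth 16 2 nu.
Proof.
move=> n12 lad nuE k; rewrite (abs_moment_power_law k nuE).
apply: (le_trans (half_logistic_abs_moment_le (n * k) lad)); rewrite lee_fin.
case: n n12 {nuE} => [|[|[|]]]// _; first by rewrite mul1n pow2_fact_le.
by rewrite ler_pM2r ?ltr0n ?fact_gt0// ler_pM2r ?exprn_gt0// ler_nat.
Qed.

Lemma product_growth n (nu : probability R R) : (0 < n <= 2)%N ->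
  (forall k, (abs_moment nu k <= ((4 * 2 ^+ k * k`!%:R) ^+ n)%:E)%E) ->
  moment_growth 16 2 nu.
Proof.
move=> n12 nuE k; apply: (le_trans (nuE k)); rewrite lee_fin.
case: n n12 {nuE} => [|[|[|]]]// _; first by rewrite expr1 pow2_fact_le.
rewrite !exprMn -exprM mulnC expr2 -natrM.
have -> : k`!%:R ^+ 2 = (k`! * k`!)%:R :> R by rewrite natrM expr2.
by rewrite ler_pM2l ?ler_nat ?fact_sqr_le// mulr_gt0// exprn_gt0.
Qed.

End growth_bounds.

Theorem mainTheorem9 (R : realType) (d : measure_display)
    (T : measurableType d) (P : probability T R)
    (n : nat) (hn : (1 <= n)%N)
    (xi : {RV P >-> R}) (hxi : has_density xi (@half_logistic_pdf R))
    (xis : 'I_n -> {RV P >-> R})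
    (hcopy : forall i : 'I_n, same_law (xis i) xi)
    (hindep : mutually_independent xis)
    (X : {RV P >-> R}) (hX : forall t : T, X t = xi t ^+ n)
    (Y : {RV P >-> R}) (hY : forall t : T, Y t = \prod_(i < n) xis i t) :
  [/\ M_det X <-> M_det Y,
      M_det X <-> (n <= 2)%N
    & (M_det X /\ M_det Y) \/ (M_indet X /\ M_indet Y)].
Proof.
have hdens i : has_half_logistic_density (distribution P (xis i)).
  by move=> A mA; exact: etrans (hcopy i A mA) (hxi A mA).
have XE : is_power_law n (distribution P xi) (distribution P X).
  by move=> A mA; congr (P _); apply/seteqP; split=> t /=; rewrite hX.
have YE : Y = prefix_RV xis n.
  by apply/mfuneqP => t; rewrite hY -prefix_prod_all.
have sX : supported_on_nonneg (distribution P X).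
  exact: (supported_power_law XE (half_logistic_supported hxi)).
have sY : supported_on_nonneg (distribution P Y).
  by rewrite YE; exact: prefix_law_supported.
have fX : finite_moments (distribution P X).
  apply: finite_moments_abs => k; rewrite (abs_moment_power_law k XE).
  exact: (le_lt_trans (half_logistic_abs_moment_le _ hxi) (ltry _)).
have mY k : (abs_moment (distribution P Y) k <= ((4 * 2 ^+ k * k`!%:R) ^+ n)%:E)%E.
  by rewrite YE; exact: prefix_law_abs_moment_le.
have fY : finite_moments (distribution P Y).
  by apply: finite_moments_abs => k; exact: (le_lt_trans (mY k) (ltry _)).
have det : (n <= 2)%N -> stieltjes_unique (distribution P X) /\
    stieltjes_unique (distribution P Y).
  move=> n2; have n12 : (0 < n <= 2)%N by rewrite hn.
  split; apply: (@moment_growth_unique _ 16 2) => //.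
    exact: (power_growth n12 hxi XE).
  exact: (product_growth n12 mY).
have indet : (3 <= n)%N -> ~ stieltjes_unique (distribution P X) /\
    ~ stieltjes_unique (distribution P Y).
  move=> n3; split.
    apply: (stretched_minorant_not_unique n3 _ _ sX (power_law_minorant hxi XE)) => //.
  have n1n : (n.-1 < n)%N by rewrite prednK.
  have [c [a [c0 a0]]] := prefix_law_minorant hindep hdens n1n.
  rewrite prednK// -YE => lb.
  exact: (stretched_minorant_not_unique n3 c0 a0 sY lb).
have [n2|n3] := leqP n 2.
  have [uX uY] := det n2.
  have dX : M_det X by [].
  have dY : M_det Y by [].
  by split; [split|split|left].
have [nX nY] := indet n3.
split; last by right.
- by split=> -[].
- by split=> [[]|].
Qed.
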